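(* For $\eta\in(0,1)$ and $n\in\mathbb{N}=\{1,2,\dots\}$ let $s_n(\eta)$ be the $n$-th smallest positive zero of $s\mapsto P_{-is-\frac12}\left(\frac{1+\eta}{1-\eta}\right)$, let $\rho=\mathrm{arccosh}\left(\frac{1+\eta}{1-\eta}\right)$, and let $E_{\mathcal N,n}(\eta)=-\log_2\tanh(\pi s_n(\eta))$. Then for each fixed $n$, as $\eta\to1^-$, $$s_n(\eta)=\frac{n\pi}{\rho}+\mathcal{O}(\rho^{-2}),\qquad E_{\mathcal N,n}(\eta)=\log_2\big(-\ln(1-\eta)\big)-\log_2(n\pi^2)+o(1).$$ In particular, for two intervals of equal length $\ell$ separated by distance $d$, for which $\eta=(1+d/\ell)^{-2}$, one has $E_{\mathcal N,n}=\log_2\big(-\ln(d/\ell)\big)-\log_2(n\pi^2)+o(1)$ as $d/\ell\to0^+$.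
   Context: $P_{-is-\frac12}(y)={}_2F_1\left(\tfrac12+is,\tfrac12-is;1;\tfrac{1-y}{2}\right)$ for $y>1$. $E_{\mathcal N,n}$ is the logarithmic negativity of the $n$-th (right-moving) mode pair between two disjoint intervals with cross ratio $\eta$ in the vacuum of the $(1+1)$-dimensional massless scalar field. *)

(* Defs.v *)
From Stdlib Require Import Reals Factorial List ClassicalEpsilon.
From Coquelicot Require Import Coquelicot.
Open Scope R_scope.

(* Rising factorial (a)_k = a (a+1) ... (a+k-1). *)
Fixpoint pochhammer (a : C) (k : nat) : C :=
  match k with
  | O => RtoC 1
  | S j => (pochhammer a j * (a + RtoC (INR j)))%C
  end.

Definition gauss_coef (a b c : C) (k : nat) : C :=
  (pochhammer a k * pochhammer b k /
   (pochhammer c k * RtoC (INR (fact k))))%C.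

Definition analytic_at (F : R -> C) (x0 : R) : Prop :=
  exists (u : nat -> C) (r : R), 0 < r /\
    forall x : R, Rabs (x - x0) < r ->
      is_pseries (V := C_R_NormedModule) u (x - x0) (F x).

(* The principal branch of 2F1(a,b;c;.), with complex parameters, on the real
   half-line x < 1, i.e. on the real points off the cut [1,+oo). By the identity
   theorem the analytic continuation of the Gauss series to this half-line is
   unique; values at x >= 1 are left unspecified. *)
Definition is_hyp2F1 (a b c : C) (F : R -> C) : Prop :=
  (forall x : R, Rabs x < 1 ->
     is_pseries (V := C_R_NormedModule) (gauss_coef a b c) x (F x)) /\
  (forall x : R, x < 1 -> analytic_at F x).

Definition hyp2F1 (a b c : C) : R -> C :=
  epsilon (inhabits (fun _ : R => RtoC 0)) (is_hyp2F1 a b c).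

(* The conical function P_{-is-1/2}(y), y > 1. *)
Definition conicalP (s y : R) : C :=
  hyp2F1 (RtoC (1 / 2) + Ci * RtoC s)%C (RtoC (1 / 2) - Ci * RtoC s)%C (RtoC 1)
    ((1 - y) / 2).

(* z is a positive zero of f, and f has exactly n zeros in (0, z]
   (so this fails for n = 0). *)
Definition is_nth_pos_zero (f : R -> C) (n : nat) (z : R) : Prop :=
  0 < z /\ f z = RtoC 0 /\
  exists l : list R, NoDup l /\ length l = n /\
    forall x : R, In x l <-> (0 < x <= z /\ f x = RtoC 0).

Definition y_of (eta : R) : R := (1 + eta) / (1 - eta).

Definition s_zero (n : nat) (eta : R) : R :=
  epsilon (inhabits 0)
    (is_nth_pos_zero (fun s : R => conicalP s (y_of eta)) n).

Definition arccosh (y : R) : R := ln (y + sqrt (y ^ 2 - 1)).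

Definition rho (eta : R) : R := arccosh (y_of eta).

Definition logneg (n : nat) (eta : R) : R :=
  - Rlog 2 (tanh (PI * s_zero n eta)).

Definition is_bigO (F : (R -> Prop) -> Prop) (f g : R -> R) : Prop :=
  exists M : R, F (fun x : R => Rabs (f x) <= M * Rabs (g x)).

(* Main.v *)
(* With [a = sinh (rho / 2)], the Mehler-Dirichlet integral reads
     P_{is-1/2}(cosh rho) = 2/PI * int_0^{PI/2} k(a sin t) dt,
     k(v) = cos(2 s arcsinh v) / sqrt(1 + v^2).
   Subtracting the exact derivative obtained by inserting a factor [cos t] gives
     PI a s P_{is-1/2}(cosh rho) = sin(s rho) + s E(s),
   where |E| <= PI and E is Lipschitz with constant PI rho, because
   2 a (1 - cos t) <= 2 sqrt(1 + a^2 sin^2 t).  In the variable sigma = s rho the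
   zeros are those of sin sigma + O(1/rho), with an O(1/rho) Lipschitz perturbation,
   so that there is exactly one near each m PI, at distance O(1/rho).

   To identify the integral with the continued Gauss series, both are viewed as
   solutions of the Legendre equation in x = - a^2.  They agree on (-1,0] by an energy
   argument starting at the singular point x = 0; solutions of the equation are
   analytic away from 0 and 1, and the identity theorem makes the continuation unique. *)

(* As [eta] tends to 1 the argument [(1 - y) / 2] tends to minus infinity, far outside the disc
   where the Gauss series converges, so a formula valid on the whole negative half-line is needed to
   see the zeros. Matching that formula with the series at 0 cannot go through the usual uniqueness
   theorem: in the variable [a] the equation has a coefficient of order [1 / a]. That singular term
   has the damping sign, which is why an energy works. The remainder E is controlled only by a bound
   and by a Lipschitz constant of size [rho]. In [sigma = s rho] the factor s becomes [sigma / rho],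
   so the term [s E(s)] obeys three estimates of order [1 / rho]: in size, relative to sigma, and in
   slope. The second one is there because the sine itself vanishes at 0, where a bound in size could
   not exclude a spurious zero; the third one replaces monotonicity when a single zero is counted
   per window. The constants depend on n through the window [(0, (n + 1/2) PI]]. *)
Require Import Defs.
From Stdlib Require Import Reals Factorial Lra Lia Psatz List Classical ClassicalEpsilon.
From Coquelicot Require Import Coquelicot.
Open Scope R_scope.

(** * The hypergeometric equation with [a + b = c = 1] *)

(* Taylor coefficients at [x0] of the solutions of
   [x (1 - x) y'' + (1 - 2 x) y' = lam y], with [p = x0 (1 - x0)] and [q = 1 - 2 x0]. *)
Definition hyp_recurrence (p q lam : R) (f : nat -> R) : Prop :=
  forall n : nat,
    p * (INR n + 2) * (INR n + 1) * f (S (S n)) + q * (INR n + 1) ^ 2 * f (S n)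
    = (INR n * (INR n + 1) + lam) * f n.

(** At [x = x0 + h] one has [x (1 - x) = p + q h - h^2] and [1 - 2 x = q - 2 h], and the recurrence
    is the vanishing of the coefficient of [h^n]. The case [p = 0], [q = 1] is the expansion at the
    singular point 0, which serves for the Gauss series. *)
Lemma PSeries_hyp_ode (p q lam : R) (f : nat -> R) (h : R) :
  hyp_recurrence p q lam f -> Rbar_lt (Rabs h) (CV_radius f) ->
  (p + q * h - h ^ 2) * PSeries (PS_derive (PS_derive f)) h
  + (q - 2 * h) * PSeries (PS_derive f) h = lam * PSeries f h.
Proof.
intros Hrec Hh.
set (f1 := PS_derive f). set (f2 := PS_derive f1).
assert (H1 : Rbar_lt (Rabs h) (CV_radius f1)) by (unfold f1; rewrite CV_radius_derive; exact Hh).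
assert (H2 : Rbar_lt (Rabs h) (CV_radius f2)) by (unfold f2; rewrite CV_radius_derive; exact H1).
assert (E2 : ex_pseries f2 h) by now apply CV_radius_inside.
assert (E1 : ex_pseries f1 h) by now apply CV_radius_inside.
assert (E0 : ex_pseries f h) by now apply CV_radius_inside.
assert (Ei : forall g : nat -> R, Rbar_lt (Rabs h) (CV_radius g) ->
  ex_pseries (PS_incr_1 g) h).
{ intros g Hg. apply CV_radius_inside. rewrite CV_radius_incr_1. exact Hg. }
assert (Eii : ex_pseries (PS_incr_1 (PS_incr_1 f2)) h).
{ apply Ei. rewrite CV_radius_incr_1. exact H2. }
assert (Es : forall (c : R) (g : nat -> R), ex_pseries g h -> ex_pseries (PS_scal c g) h).
{ intros c g Hg. apply (ex_pseries_scal (K := R_AbsRing) (V := R_NormedModule)); trivial.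
  apply Rmult_comm. }
pose (T := PS_plus (PS_plus (PS_scal p f2) (PS_scal q (PS_incr_1 f2)))
   (PS_plus (PS_scal (-1) (PS_incr_1 (PS_incr_1 f2)))
     (PS_plus (PS_scal q f1) (PS_plus (PS_scal (-2) (PS_incr_1 f1)) (PS_scal (- lam) f))))).
assert (HT : PSeries T h = 0).
{ rewrite <- (PSeries_const_0 h). apply PSeries_ext. intros n.
  unfold T, PS_plus, PS_scal, f2, f1, PS_derive. simpl.
  unfold plus, scal; simpl. unfold mult; simpl.
  (* The term in [h^2] shifts coefficients twice, so the first two indices are read off
     separately. *)
  destruct n as [|[|n]].
  - pose proof (Hrec 0%nat) as Hr. simpl in Hr |- *. unfold zero; simpl. lra.
  - pose proof (Hrec 1%nat) as Hr. simpl in Hr |- *. unfold zero; simpl. lra.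
  - pose proof (Hrec (S (S n))) as Hr. rewrite !S_INR in Hr. cbn [PS_incr_1].
    change (match n with 0%nat => 1 | S _ => INR n + 1 end) with (INR (S n)).
    rewrite !S_INR. lra. }
unfold T in HT.
rewrite !PSeries_plus, !PSeries_scal, !PSeries_incr_1 in HT;
  repeat match goal with
  | |- ex_pseries (PS_plus _ _) _ => apply (ex_pseries_plus (K := R_AbsRing) (V := R_NormedModule))
  | |- ex_pseries (PS_scal _ _) _ => apply Es
  | |- ex_pseries (PS_incr_1 (PS_incr_1 _)) _ => exact Eii
  | |- ex_pseries (PS_incr_1 _) _ => apply Ei
  end; trivial.
simpl. lra.
Qed.

Fixpoint hyp_coefs (p q lam u v : R) (n : nat) : R * R :=
  match n with
  | O => (u, v)
  | S m => let (a, b) := hyp_coefs p q lam u v m in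
    (b, ((INR m * (INR m + 1) + lam) * a - q * (INR m + 1) ^ 2 * b)
        / (p * (INR m + 2) * (INR m + 1)))
  end.

Lemma hyp_recurrence_ex (p q lam u v : R) : p <> 0 ->
  exists f : nat -> R, hyp_recurrence p q lam f /\ f 0%nat = u /\ f 1%nat = v.
Proof.
intros Hp. exists (fun n => fst (hyp_coefs p q lam u v n)).
split; [|split; reflexivity].
intros n. simpl. destruct (hyp_coefs p q lam u v n) as [a b]. simpl.
pose proof (pos_INR n). field. repeat split; lra.
Qed.

(** The recurrence bounds each coefficient by a fixed multiple of the two preceding ones, hence
    geometric growth. The radius found is crude, but analyticity is local and asks only for a
    positive one. *)
Lemma hyp_recurrence_radius (p q lam : R) (f : nat -> R) : p <> 0 ->
  hyp_recurrence p q lam f -> exists r : R, 0 < r /\ Rbar_lt r (CV_radius f).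
Proof.
intros Hp Hrec.
set (A := (Rabs q + 1 + Rabs lam) / Rabs p).
assert (Hp' : 0 < Rabs p) by now apply Rabs_pos_lt.
assert (HA : 0 < A).
{ apply Rdiv_lt_0_compat; trivial. pose proof (Rabs_pos q); pose proof (Rabs_pos lam); lra. }
assert (Hstep : forall n, Rabs (f (S (S n))) <= A * (Rabs (f (S n)) + Rabs (f n))).
{ intros n. pose proof (pos_INR n) as Hn. pose proof (Hrec n) as Hr.
  assert (Hb : Rabs p * ((INR n + 2) * (INR n + 1)) * Rabs (f (S (S n)))
     <= (Rabs q + 1 + Rabs lam) * ((INR n + 2) * (INR n + 1)) * (Rabs (f (S n)) + Rabs (f n))).
  { replace (Rabs p * ((INR n + 2) * (INR n + 1)) * Rabs (f (S (S n)))) with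
     (Rabs ((INR n * (INR n + 1) + lam) * f n + - (q * (INR n + 1) ^ 2 * f (S n)))).
    2:{ rewrite <- Hr. rewrite <- (Rabs_pos_eq ((INR n + 2) * (INR n + 1))) by nra.
        rewrite <- !Rabs_mult. f_equal. ring. }
    eapply Rle_trans; [apply Rabs_triang|]. rewrite Rabs_Ropp, !Rabs_mult.
    rewrite (Rabs_pos_eq ((INR n + 1) ^ 2)) by nra.
    assert (Rabs (INR n * (INR n + 1) + lam) <= (1 + Rabs lam) * ((INR n + 2) * (INR n + 1))).
    { eapply Rle_trans; [apply Rabs_triang|]. rewrite Rabs_pos_eq by nra.
      pose proof (Rabs_pos lam). nra. }
    pose proof (Rabs_pos q). pose proof (Rabs_pos lam).
    pose proof (Rabs_pos (f n)). pose proof (Rabs_pos (f (S n))).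
    assert (Rabs (INR n * (INR n + 1) + lam) * Rabs (f n) <=
      (1 + Rabs lam) * ((INR n + 2) * (INR n + 1)) * Rabs (f n)) by (apply Rmult_le_compat_r; lra).
    assert (Rabs q * (INR n + 1) ^ 2 * Rabs (f (S n)) <= Rabs q * ((INR n + 2) * (INR n + 1)) * Rabs (f (S n))).
    { apply Rmult_le_compat_r; trivial. apply Rmult_le_compat_l; trivial. nra. }
    assert (0 <= (INR n + 2) * (INR n + 1)) by nra.
    assert (0 <= Rabs q * ((INR n + 2) * (INR n + 1)) * Rabs (f n)) by (apply Rmult_le_pos; [apply Rmult_le_pos|]; trivial).
    assert (0 <= (1 + Rabs lam) * ((INR n + 2) * (INR n + 1)) * Rabs (f (S n))) by (apply Rmult_le_pos; [apply Rmult_le_pos|]; lra).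
    lra. }
  unfold A. apply Rmult_le_reg_l with (Rabs p * ((INR n + 2) * (INR n + 1))).
  - apply Rmult_lt_0_compat; nra.
  - eapply Rle_trans; [exact Hb|]. right. field. lra. }
(* The induction needs [A (B + 1) <= B^2]; since [B >= 1], [A (B + 1) <= 2 A B <= B^2]. *)
set (B := 1 + 2 * A). set (M := Rabs (f 0%nat) + Rabs (f 1%nat)).
assert (HB : 0 < B) by (unfold B; lra).
assert (HM : forall n, Rabs (f n) <= M * B ^ n /\ Rabs (f (S n)) <= M * B ^ S n).
{ pose proof (Rabs_pos (f 0%nat)). pose proof (Rabs_pos (f 1%nat)).
  induction n as [|n [I1 I2]].
  - unfold M, B. simpl. split; nra.
  - split; trivial. eapply Rle_trans; [apply Hstep|].
    assert (0 <= M * B ^ n). { apply Rmult_le_pos; [unfold M; lra|]. apply pow_le; lra. }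
    simpl in I2 |- *. set (w := M * B ^ n) in *.
    replace (M * (B * (B * B ^ n))) with (B * B * w) by (unfold w; ring).
    replace (M * (B * B ^ n)) with (B * w) in I2 by (unfold w; ring).
    assert (A * (Rabs (f (S n)) + Rabs (f n)) <= A * (B * w + w)) by (apply Rmult_le_compat_l; lra).
    assert (1 <= B) by (unfold B; lra).
    assert (w <= B * w) by nra.
    assert (A * (B * w + w) <= A * (2 * (B * w))) by (apply Rmult_le_compat_l; lra).
    assert (0 <= B * w) by lra.
    unfold B in *. nra. }
exists (/ B / 2).
assert (HiB : 0 < / B) by now apply Rinv_0_lt_compat.
split; [lra|].
apply Rbar_lt_le_trans with (/ B); [simpl; lra|].
apply (proj1 (CV_radius_bounded f)).
exists M. intros n. rewrite Rabs_mult, <- RPow_abs, (Rabs_pos_eq (/ B)) by lra.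
apply Rmult_le_reg_r with (B ^ n); [now apply pow_lt|].
replace (Rabs (f n) * (/ B) ^ n * B ^ n) with (Rabs (f n)).
- apply HM.
- rewrite Rmult_assoc, <- Rpow_mult_distr, Rinv_l, pow1 by lra. ring.
Qed.

(** * Uniqueness for second-order linear equations, and analyticity of their solutions *)

Lemma is_derive_continuity_pt (f : R -> R) (x l : R) : is_derive f x l -> continuity_pt f x.
Proof.
intros H. apply derivable_continuous_pt. exists l. now apply is_derive_Reals.
Qed.

Lemma gronwall_zero (E E' : R -> R) (x0 r L : R) : 0 < r ->
  (forall x, Rabs (x - x0) < r -> is_derive E x (E' x)) ->
  (forall x, Rabs (x - x0) < r -> 0 <= E x /\ Rabs (E' x) <= L * E x) ->
  E x0 = 0 -> forall x, Rabs (x - x0) < r -> E x = 0.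
Proof.
intros Hr HE Hb H0 x Hx.
assert (HD : forall k t, Rabs (t - x0) < r ->
  is_derive (fun u => E u * exp (k * (u - x0))) t ((E' t + k * E t) * exp (k * (t - x0)))).
{ intros k t Ht. pose proof (HE t Ht) as Hd. auto_derive.
  - eexists; exact Hd.
  - rewrite (is_derive_unique (fun x : R => E x) _ _ Hd). unfold Rminus. ring. }
apply Rle_antisym; [|apply Hb; trivial].
(* The sign of [k] makes [E u * exp (k (u - x0))] nonincreasing when moving away from [x0], on
   either side; it starts at 0 and [E] is nonnegative. *)
set (k := if Rle_dec x0 x then - L else L).
destruct (MVT_gen (fun u => E u * exp (k * (u - x0))) x0 x
  (fun t => (E' t + k * E t) * exp (k * (t - x0)))) as (c & Hc & Heq).
- intros t Ht. apply HD.
  revert Ht. unfold Rmin, Rmax; destruct (Rle_dec x0 x); revert Hx; unfold Rabs;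
   destruct (Rcase_abs (x - x0)); destruct (Rcase_abs (t - x0)); lra.
- intros t Ht. eapply is_derive_continuity_pt. apply HD.
  revert Ht. unfold Rmin, Rmax; destruct (Rle_dec x0 x); revert Hx; unfold Rabs;
   destruct (Rcase_abs (x - x0)); destruct (Rcase_abs (t - x0)); lra.
- assert (Hcr : Rabs (c - x0) < r).
  { revert Hc. unfold Rmin, Rmax; destruct (Rle_dec x0 x); revert Hx; unfold Rabs;
   destruct (Rcase_abs (x - x0)); destruct (Rcase_abs (c - x0)); lra. }
  destruct (Hb c Hcr) as [Hp Ha]. rewrite H0 in Heq.
  pose proof (exp_pos (k * (c - x0))) as Hec. pose proof (exp_pos (k * (x - x0))) as Hex.
  assert (Hs : (E' c + k * E c) * (x - x0) <= 0).
  { revert Ha; unfold k; destruct (Rle_dec x0 x); unfold Rabs; destruct (Rcase_abs (E' c)); intros; nra. }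
  assert (E x * exp (k * (x - x0)) <= 0).
  { replace (E x * exp (k * (x - x0))) with ((E' c + k * E c) * (x - x0) * exp (k * (c - x0))) by lra.
    nra. }
  nra.
Qed.

Lemma linear_ode_unique (y y1 y2 al be : R -> R) (x0 r L : R) : 0 < r -> 0 <= L ->
  (forall x, Rabs (x - x0) < r -> is_derive y x (y1 x)) ->
  (forall x, Rabs (x - x0) < r -> is_derive y1 x (y2 x)) ->
  (forall x, Rabs (x - x0) < r -> y2 x = al x * y1 x + be x * y x) ->
  (forall x, Rabs (x - x0) < r -> Rabs (al x) <= L /\ Rabs (be x) <= L) ->
  y x0 = 0 -> y1 x0 = 0 -> forall x, Rabs (x - x0) < r -> y x = 0.
Proof.
intros Hr HL Hy Hy1 Hode Hb H0 H1 x Hx.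
assert (HE : y x ^ 2 + y1 x ^ 2 = 0).
{ apply (gronwall_zero (fun t => y t ^ 2 + y1 t ^ 2)
   (fun t => 2 * y t * y1 t + 2 * y1 t * y2 t) x0 r (1 + 3 * L)); trivial.
  - intros t Ht. pose proof (Hy t Ht) as D1. pose proof (Hy1 t Ht) as D2. auto_derive.
    + repeat split; eexists; eassumption.
    + rewrite (is_derive_unique (fun x : R => y x) _ _ D1), (is_derive_unique (fun x : R => y1 x) _ _ D2). ring.
  - intros t Ht. split; [nra|]. rewrite (Hode t Ht). destruct (Hb t Ht) as [Ha Hbe].
    set (u := y t). set (v := y1 t).
    replace (2 * u * v + 2 * v * (al t * v + be t * u))
      with (2 * u * v + (2 * al t * v ^ 2 + be t * (2 * u * v))) by ring.
    eapply Rle_trans; [apply Rabs_triang|].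
    assert (Huv : Rabs (2 * u * v) <= u ^ 2 + v ^ 2) by (pose proof (pow2_ge_0 (u + v)); pose proof (pow2_ge_0 (u - v)); apply Rabs_le; lra).
    assert (Rabs (2 * al t * v ^ 2 + be t * (2 * u * v)) <= 2 * L * v ^ 2 + L * (u ^ 2 + v ^ 2)).
    { eapply Rle_trans; [apply Rabs_triang|].
      rewrite (Rabs_mult (2 * al t)), (Rabs_mult 2 (al t)), (Rabs_mult (be t)).
      rewrite (Rabs_pos_eq 2), (Rabs_pos_eq (v ^ 2)) by nra.
      apply Rplus_le_compat.
      - apply Rmult_le_compat_r; [apply pow2_ge_0 | lra].
      - apply Rmult_le_compat; try apply Rabs_pos; trivial. }
    assert (0 <= L * u ^ 2) by (apply Rmult_le_pos; nra). lra.
  - rewrite H0, H1. ring. }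
nra.
Qed.

(** * Real-analytic functions *)

Definition real_analytic_at (f : R -> R) (x0 : R) : Prop :=
  exists (u : nat -> R) (r : R), 0 < r /\
    forall x : R, Rabs (x - x0) < r -> is_pseries u (x - x0) (f x).

Lemma is_derive_shift (f : R -> R) (x0 x l : R) :
  is_derive f (x - x0) l -> is_derive (fun t => f (t - x0)) x l.
Proof.
intros H. replace l with (scal 1 l) by (unfold scal; simpl; unfold mult; simpl; ring).
apply (is_derive_comp (K := R_AbsRing) (V := R_NormedModule) f (fun t => t - x0)); trivial.
auto_derive; trivial.
Qed.

Lemma is_derive_minus_R (f g : R -> R) (x a b : R) :
  is_derive f x a -> is_derive g x b -> is_derive (fun t => f t - g t) x (a - b).
Proof. intros H K. exact (is_derive_minus _ _ _ _ _ H K). Qed.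

(** The power series with the same value and slope at [x0] solves the same equation; away from 0 and
    1 the equation can be divided by [x (1 - x)], and linear uniqueness identifies [y] with that
    series. *)
Lemma hyp_ode_analytic (lam : R) (y y1 y2 : R -> R) (x0 r : R) :
  0 < r -> x0 <> 0 -> x0 <> 1 ->
  (forall x, Rabs (x - x0) < r -> is_derive y x (y1 x)) ->
  (forall x, Rabs (x - x0) < r -> is_derive y1 x (y2 x)) ->
  (forall x, Rabs (x - x0) < r -> x * (1 - x) * y2 x + (1 - 2 * x) * y1 x = lam * y x) ->
  real_analytic_at y x0.
Proof.
intros Hr Hx0 Hx1 Hy Hy1 Hode.
set (p := x0 * (1 - x0)). set (q := 1 - 2 * x0).
assert (Hp : p <> 0) by (apply Rmult_integral_contrapositive; split; lra).
assert (Hp' : 0 < Rabs p) by now apply Rabs_pos_lt.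
pose proof (Rabs_pos q) as Hq.
destruct (hyp_recurrence_ex p q lam (y x0) (y1 x0) Hp) as (f & Hrec & Hf0 & Hf1).
destruct (hyp_recurrence_radius p q lam f Hp Hrec) as (r1 & Hr1 & Hcv).
(* With [h = x - x0], [x (1 - x)] differs from [p] by [h^2 - q h], at most [(|q| + 1) |h|] for
   [|h| <= 1]. This radius keeps the difference below [|p| / 2]. *)
set (del := Rmin 1 (Rabs p / (2 * (Rabs q + 1)))).
assert (Hdel : 0 < del).
{ apply Rmin_pos; [lra|]. apply Rdiv_lt_0_compat; lra. }
set (r2 := Rmin r (Rmin r1 del)).
assert (Hr2 : 0 < r2) by (apply Rmin_pos; [|apply Rmin_pos]; trivial).
assert (Hle : r2 <= r /\ r2 <= r1 /\ r2 <= 1 /\ r2 <= Rabs p / (2 * (Rabs q + 1))).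
{ unfold r2, del. pose proof (Rmin_l r (Rmin r1 del)). pose proof (Rmin_r r (Rmin r1 del)).
  pose proof (Rmin_l r1 del). pose proof (Rmin_r r1 del).
  pose proof (Rmin_l 1 (Rabs p / (2 * (Rabs q + 1)))). pose proof (Rmin_r 1 (Rabs p / (2 * (Rabs q + 1)))).
  unfold del in *. lra. }
assert (Hin : forall x, Rabs (x - x0) < r2 -> Rbar_lt (Rabs (x - x0)) (CV_radius f)).
{ intros x Hx. eapply Rbar_lt_trans; [|exact Hcv]. simpl. lra. }
assert (Hlow : forall x, Rabs (x - x0) < r2 -> Rabs p / 2 <= Rabs (x * (1 - x))).
{ intros x Hx. set (h := x - x0) in *.
  replace (x * (1 - x)) with (p - (h * h - q * h)) by (unfold p, q, h; ring).
  pose proof (Rabs_triang_inv p (h * h - q * h)).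
  assert (Rabs (h * h - q * h) <= Rabs p / 2).
  { replace (h * h - q * h) with ((h - q) * h) by ring. rewrite Rabs_mult.
    assert (Rabs (h - q) <= Rabs q + 1).
    { unfold Rminus. eapply Rle_trans; [apply Rabs_triang|]. rewrite Rabs_Ropp. lra. }
    apply Rle_trans with ((Rabs q + 1) * (Rabs p / (2 * (Rabs q + 1)))).
    - apply Rmult_le_compat; try apply Rabs_pos; lra.
    - right. field. lra. }
  lra. }
set (L := (Rabs q + 2 + Rabs lam) * (2 / Rabs p)).
pose proof (Rabs_pos lam) as Hlam.
assert (Hdp : 0 < 2 / Rabs p) by (apply Rdiv_lt_0_compat; lra).
assert (Hden : forall x, Rabs (x - x0) < r2 -> x * (1 - x) <> 0 /\ Rabs (/ (x * (1 - x))) <= 2 / Rabs p).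
{ intros x Hx. pose proof (Hlow x Hx) as Hl.
  assert (Hnz : x * (1 - x) <> 0).
  { intros E. rewrite E, Rabs_R0 in Hl. lra. }
  split; trivial. rewrite Rabs_inv.
  replace (2 / Rabs p) with (/ (Rabs p / 2)) by (field; lra).
  apply Rinv_le_contravar; lra. }
set (Y := PSeries f). set (Y1 := PSeries (PS_derive f)). set (Y2 := PSeries (PS_derive (PS_derive f))).
assert (Hd : forall x, Rabs (x - x0) < r2 -> y x - Y (x - x0) = 0).
{ apply (linear_ode_unique (fun x => y x - Y (x - x0)) (fun x => y1 x - Y1 (x - x0))
    (fun x => y2 x - Y2 (x - x0))
    (fun x => - (1 - 2 * x) / (x * (1 - x))) (fun x => lam / (x * (1 - x))) x0 r2 L); trivial.
  - unfold L. apply Rmult_le_pos; lra.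
  - intros x Hx. apply is_derive_minus_R; [apply Hy; lra|].
    apply is_derive_shift, is_derive_PSeries, Hin, Hx.
  - intros x Hx. apply is_derive_minus_R; [apply Hy1; lra|].
    apply is_derive_shift, is_derive_PSeries. rewrite CV_radius_derive. apply Hin, Hx.
  - intros x Hx. pose proof (Hode x ltac:(lra)) as O1.
    pose proof (PSeries_hyp_ode p q lam f (x - x0) Hrec (Hin x Hx)) as O2.
    fold Y Y1 Y2 in O2. destruct (Hden x Hx) as [Hnz _].
    replace (p + q * (x - x0) - (x - x0) ^ 2) with (x * (1 - x)) in O2 by (unfold p, q; ring).
    replace (q - 2 * (x - x0)) with (1 - 2 * x) in O2 by (unfold q; ring).
    apply Rmult_eq_reg_l with (x * (1 - x)); trivial.
    transitivity (- (1 - 2 * x) * (y1 x - Y1 (x - x0)) + lam * (y x - Y (x - x0))).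
    + lra.
    + field. split; intros E; apply Hnz; [replace x with 1 by lra | rewrite E]; ring.
  - intros x Hx. destruct (Hden x Hx) as [_ Hi]. unfold Rdiv. rewrite !Rabs_mult.
    assert (Hq2 : Rabs (- (1 - 2 * x)) <= Rabs q + 2).
    { replace (- (1 - 2 * x)) with (- q + 2 * (x - x0)) by (unfold q; ring).
      eapply Rle_trans; [apply Rabs_triang|]. rewrite Rabs_Ropp, Rabs_mult, (Rabs_pos_eq 2) by lra. lra. }
    unfold L. split; apply Rmult_le_compat; try apply Rabs_pos; lra.
  - unfold Y. rewrite Rminus_diag, PSeries_0, Hf0. ring.
  - unfold Y1. rewrite Rminus_diag, PSeries_0. unfold PS_derive. rewrite Hf1. simpl. ring. }
exists f, r2. split; trivial. intros x Hx.
replace (y x) with (PSeries f (x - x0)) by (pose proof (Hd x Hx) as K; unfold Y in K; lra).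
apply PSeries_correct, CV_radius_inside, Hin, Hx.
Qed.

(** By continuity the constant coefficient is the limit from the right, hence 0; dividing by [h]
    shifts the coefficients and the argument repeats. One-sided vanishing is exactly what the
    supremum in [analytic_identity] supplies. *)
Lemma pseries_zero_right (u : nat -> R) (r : R) : 0 < r ->
  (forall h, 0 < h < r -> is_pseries u h 0) -> forall n, u n = 0.
Proof.
intros Hr.
assert (Hcv : forall v : nat -> R, (forall h, 0 < h < r -> is_pseries v h 0) ->
  Rbar_lt 0 (CV_radius v)).
{ intros v Hv. apply Rbar_lt_le_trans with (r / 2); [simpl; lra|].
  apply Rbar_not_lt_le. intros Hlt.
  assert (Hlt' : Rbar_lt (CV_radius v) (Rabs (r / 2))) by (rewrite Rabs_pos_eq by lra; exact Hlt).
  apply (CV_disk_outside v (r / 2)) in Hlt'. apply Hlt'.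
  assert (Hs : is_pseries v (r / 2) 0) by (apply Hv; lra).
  apply is_pseries_R in Hs. apply ex_series_lim_0. exists 0. exact Hs. }
assert (H0 : forall v : nat -> R, (forall h, 0 < h < r -> is_pseries v h 0) -> v 0%nat = 0).
{ intros v Hv. pose proof (Hcv v Hv) as Hc.
  rewrite <- (PSeries_0 v).
  assert (Hct : continuity_pt (PSeries v) 0).
  { apply PSeries_continuity. rewrite Rabs_R0. exact Hc. }
  destruct (Req_dec (PSeries v 0) 0) as [E|N]; trivial. exfalso.
  destruct (Hct (Rabs (PSeries v 0)) (Rabs_pos_lt _ N)) as (al & Hal & Hlim).
  set (h := Rmin al r / 2). assert (Hm : 0 < Rmin al r) by now apply Rmin_pos.
  pose proof (Rmin_l al r). pose proof (Rmin_r al r).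
  assert (Hh : 0 < h < r) by (unfold h; lra).
  specialize (Hlim h). simpl in Hlim. unfold R_dist in Hlim.
  rewrite (is_pseries_unique v h 0 (Hv h Hh)) in Hlim.
  assert (K : Rabs (0 - PSeries v 0) < Rabs (PSeries v 0)).
  { apply Hlim. split.
    - split; [exact I | intros E; lra].
    - rewrite Rminus_0_r, Rabs_pos_eq; unfold h; lra. }
  rewrite Rminus_0_l, Rabs_Ropp in K. lra. }
intros Hu n. revert u Hu. induction n as [|n IH]; intros u Hu.
- now apply H0.
- change (u (S n)) with (PS_decr_1 u n). apply IH. intros h Hh.
  assert (Hex : ex_pseries u h) by (exists 0; now apply Hu).
  assert (Hex1 : ex_pseries (PS_decr_1 u) h).
  { apply ex_pseries_decr_1; trivial. right. exists (/ h). unfold mult; simpl. unfold one; simpl. field. lra. }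
  replace 0 with (PSeries (PS_decr_1 u) h); [now apply PSeries_correct|].
  pose proof (PSeries_decr_1 u h Hex) as E.
  rewrite (is_pseries_unique u h 0 (Hu h Hh)), (H0 u Hu) in E.
  apply Rmult_eq_reg_l with h; lra.
Qed.

(** Let [m] be the supremum of the points up to [x0] where [D] is nonzero. Then [D] vanishes just to
    the right of [m], so its expansion at [m] is zero and [D] also vanishes just to the left, a
    contradiction. The interval up to [x1] provides room to the right even when [m = x0]. *)
Lemma analytic_identity (D : R -> R) (b x0 x1 : R) : x0 < x1 < b ->
  (forall x, x < b -> real_analytic_at D x) ->
  (forall x, x0 < x < x1 -> D x = 0) -> forall x, x <= x0 -> D x = 0.
Proof.
intros Hb Han Hz x Hx. apply NNPP. intros Hnz.
destruct (completeness (fun t => t <= x0 /\ D t <> 0)) as (m & Hub & Hlub).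
- exists x0. intros t [Ht _]. exact Ht.
- exists x. split; trivial.
- assert (Hm : m <= x0) by (apply Hlub; intros t [Ht _]; exact Ht).
  destruct (Han m ltac:(lra)) as (u & r & Hr & Hu).
  assert (Hright : forall t, m < t < x1 -> D t = 0).
  { intros t Ht. destruct (Rle_dec t x0) as [Hle|Hgt].
    - apply NNPP. intros N. pose proof (Hub t (conj Hle N)). lra.
    - apply Hz. lra. }
  assert (Hu0 : forall n, u n = 0).
  { apply (pseries_zero_right u (Rmin r (x1 - m))).
    - apply Rmin_pos; lra.
    - intros h Hh. pose proof (Rmin_l r (x1 - m)). pose proof (Rmin_r r (x1 - m)).
      rewrite <- (Hright (m + h)) by lra.
      replace h with (m + h - m) at 1 by ring. apply Hu.
      replace (m + h - m) with h by ring. rewrite Rabs_pos_eq; lra. }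
  assert (m <= m - r / 2); [|lra].
  apply Hlub. intros t [Ht Nt]. apply Rnot_lt_le. intros Hlt.
  pose proof (Hub t (conj Ht Nt)). apply Nt.
  rewrite <- (is_pseries_unique _ _ _ (Hu t ltac:(rewrite Rabs_left1; lra))).
  rewrite <- (PSeries_const_0 (t - m)). now apply PSeries_ext.
Qed.

Lemma sum_n_fst (a : nat -> C_R_NormedModule) n : fst (sum_n a n) = sum_n (fun k => fst (a k) : R) n.
Proof.
induction n as [|n IH]; [now rewrite !sum_O|]. rewrite !sum_Sn, <- IH. reflexivity.
Qed.

Lemma sum_n_snd (a : nat -> C_R_NormedModule) n : snd (sum_n a n) = sum_n (fun k => snd (a k) : R) n.
Proof.
induction n as [|n IH]; [now rewrite !sum_O|]. rewrite !sum_Sn, <- IH. reflexivity.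
Qed.

Lemma is_pseries_C_iff (u : nat -> C) (x : R) (l : C) :
  is_pseries (V := C_R_NormedModule) u x l <->
  is_pseries (fun n => Re (u n)) x (Re l) /\ is_pseries (fun n => Im (u n)) x (Im l).
Proof.
unfold is_pseries, is_series. split.
- intros H. split.
  + apply filterlim_ext with (fun n => fst (sum_n (fun k => scal (pow_n x k) (u k : C_R_NormedModule)) n)).
    { intros n. rewrite sum_n_fst. apply sum_n_ext. reflexivity. }
    eapply filterlim_comp; [exact H|]. intros P [e He]. exists e. intros [a b] [Ha _]. apply He, Ha.
  + apply filterlim_ext with (fun n => snd (sum_n (fun k => scal (pow_n x k) (u k : C_R_NormedModule)) n)).
    { intros n. rewrite sum_n_snd. apply sum_n_ext. reflexivity. }
    eapply filterlim_comp; [exact H|]. intros P [e He]. exists e. intros [a b] [_ Hb]. apply He, Hb.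
- intros [H1 H2]. intros P [e He].
  assert (E1 := H1 _ (locally_ball (Re l) e)). assert (E2 := H2 _ (locally_ball (Im l) e)).
  unfold filtermap in *. generalize (filter_and _ _ E1 E2). apply filter_imp.
  intros n [B1 B2]. apply He. split.
  + rewrite sum_n_fst. exact B1.
  + rewrite sum_n_snd. exact B2.
Qed.

(** * The Mehler-Dirichlet integral *)

(* The elementary function [2F1(1/2 + is, 1/2 - is; 1/2; - v^2)]. *)
Definition mehler_kernel (s v : R) : R := cos (2 * s * arcsinh v) / sqrt (v ^ 2 + 1).

Definition mehler_kernel1 (s v : R) : R :=
  - (2 * s * sin (2 * s * arcsinh v)) / (v ^ 2 + 1)
  - v * cos (2 * s * arcsinh v) / ((v ^ 2 + 1) * sqrt (v ^ 2 + 1)).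

(** Second derivative, solved from the kernel's equation [(1 + v^2) k'' + 3 v k' + (1 + 4 s^2) k =
    0]; [is_derive_mehler_kernel1] is the verification of that equation. *)
Definition mehler_kernel2 (s v : R) : R :=
  - (3 * v * mehler_kernel1 s v + (1 + 4 * s ^ 2) * mehler_kernel s v) / (v ^ 2 + 1).

Lemma sqrt_sqr1 (v : R) : 0 < sqrt (v ^ 2 + 1) /\ sqrt (v ^ 2 + 1) * sqrt (v ^ 2 + 1) = v ^ 2 + 1.
Proof.
split; [apply sqrt_lt_R0; nra | apply sqrt_sqrt; nra].
Qed.

Lemma is_derive_arcsinh (v : R) : is_derive arcsinh v (/ sqrt (v ^ 2 + 1)).
Proof. apply is_derive_Reals, derivable_pt_lim_arcsinh. Qed.

Lemma is_derive_mehler_kernel (s v : R) :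
  is_derive (mehler_kernel s) v (mehler_kernel1 s v).
Proof.
unfold mehler_kernel, mehler_kernel1. destruct (sqrt_sqr1 v) as [Hp Hs].
auto_derive.
- replace (v * (v * 1) + 1) with (v ^ 2 + 1) by ring.
  repeat split; try nra. eexists; apply is_derive_arcsinh.
- rewrite (is_derive_unique (fun x : R => arcsinh x) _ _ (is_derive_arcsinh v)).
  replace (v * (v * 1) + 1) with (v ^ 2 + 1) by ring.
  revert Hp Hs. generalize (sqrt (v ^ 2 + 1)). intros W Hp Hs. rewrite <- Hs. field. lra.
Qed.

Lemma is_derive_mehler_kernel1 (s v : R) :
  is_derive (mehler_kernel1 s) v (mehler_kernel2 s v).
Proof.
unfold mehler_kernel2. unfold mehler_kernel, mehler_kernel1. destruct (sqrt_sqr1 v) as [Hp Hs].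
assert (Hv : v ^ 2 + 1 <> 0) by nra.
auto_derive.
- replace (v * (v * 1) + 1) with (v ^ 2 + 1) by ring.
  repeat split; try nra; try (eexists; apply is_derive_arcsinh).
- rewrite (is_derive_unique (fun x : R => arcsinh x) _ _ (is_derive_arcsinh v)).
  replace (v * (v * 1) + 1) with (v ^ 2 + 1) by ring.
  revert Hp Hs. generalize (sqrt (v ^ 2 + 1)). intros W Hp Hs.
  replace (v ^ 2 + 1) with (W * W). field_simplify_eq; [|lra].
  replace (v ^ 2) with (W * W - 1) by lra. ring.
Qed.

Lemma mehler_kernel_continuous (s v : R) :
  continuity_pt (mehler_kernel s) v /\ continuity_pt (mehler_kernel1 s) v
  /\ continuity_pt (mehler_kernel2 s) v.
Proof.
assert (H0 : continuity_pt (mehler_kernel s) v)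
 by (eapply is_derive_continuity_pt; apply is_derive_mehler_kernel).
assert (H1 : continuity_pt (mehler_kernel1 s) v)
 by (eapply is_derive_continuity_pt; apply is_derive_mehler_kernel1).
repeat split; trivial.
unfold mehler_kernel2. eapply is_derive_continuity_pt. auto_derive.
- repeat split; try nra; eexists;
  [apply is_derive_mehler_kernel1 | apply is_derive_mehler_kernel].
- reflexivity.
Qed.

Lemma continuity_ex_RInt (f : R -> R) (a b : R) : (forall x, continuity_pt f x) -> ex_RInt f a b.
Proof.
intros H. apply (ex_RInt_continuous (V := R_CompleteNormedModule)).
intros x _. apply continuity_pt_filterlim, H.
Qed.

Lemma continuity_pt_comp_sin (g : R -> R) (a t : R) :
  (forall v, continuity_pt g v) -> continuity_pt (fun t => g (a * sin t)) t.
Proof.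
intros Hg. apply (continuity_pt_comp (fun t => a * sin t) g); [|apply Hg].
apply (is_derive_continuity_pt _ _ (a * cos t)). auto_derive; trivial. ring.
Qed.

(** The weight [w] absorbs the factor [sin t] produced by each differentiation, so one statement
    yields both derivatives of the integral. *)
Lemma is_derive_RInt_comp_sin (w g g1 : R -> R) (a b c : R) :
  (forall t, continuity_pt w t) ->
  (forall v, is_derive g v (g1 v)) -> (forall v, continuity_pt g1 v) ->
  is_derive (fun a => RInt (fun t => w t * g (a * sin t)) b c) a
    (RInt (fun t => w t * sin t * g1 (a * sin t)) b c).
Proof.
intros Hw Hg Hg1.
assert (HD : forall t x, is_derive (fun u => w t * g (u * sin t)) x (w t * sin t * g1 (x * sin t))).
{ intros t x. pose proof (Hg (x * sin t)) as K. auto_derive; [eexists; exact K|].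
  rewrite (is_derive_unique (fun x : R => g x) _ _ K). ring. }
assert (Hgc : forall v, continuity_pt g v) by (intros v; eapply is_derive_continuity_pt; apply Hg).
replace (RInt (fun t => w t * sin t * g1 (a * sin t)) b c) with
  (RInt (fun t => Derive (fun u => w t * g (u * sin t)) a) b c).
2:{ apply RInt_ext. intros t _. apply is_derive_unique, HD. }
apply (is_derive_RInt_param (fun a t => w t * g (a * sin t))).
- exists (mkposreal 1 Rlt_0_1). intros x _ t _. eexists. apply HD.
- intros t _. apply continuity_2d_pt_ext with (fun u t => w t * sin t * g1 (u * sin t)).
  { intros x y. symmetry. apply is_derive_unique, HD. }
  assert (Hs : continuity_2d_pt (fun _ t => sin t) a t).
  { apply (continuity_1d_2d_pt_comp sin (fun _ t => t)); [apply continuity_sin | apply continuity_2d_pt_id2]. }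
  apply continuity_2d_pt_mult; [apply continuity_2d_pt_mult|].
  + apply (continuity_1d_2d_pt_comp w (fun _ t => t)); [apply Hw | apply continuity_2d_pt_id2].
  + exact Hs.
  + apply (continuity_1d_2d_pt_comp g1 (fun u t => u * sin t)); [apply Hg1|].
    apply continuity_2d_pt_mult; [apply continuity_2d_pt_id1 | exact Hs].
- exists (mkposreal 1 Rlt_0_1). intros x _. apply continuity_ex_RInt. intros t.
  apply continuity_pt_mult; [apply Hw|]. now apply continuity_pt_comp_sin.
Qed.

(* The Mehler-Dirichlet integral for [P_{is-1/2}(cosh rho)], rewritten with
   [sinh (t/2) = a sin phi] and [a = sinh (rho/2)]. *)
Definition mehler (s a : R) : R := 2 / PI * RInt (fun t => mehler_kernel s (a * sin t)) 0 (PI / 2).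

Definition mehler1 (s a : R) : R :=
  2 / PI * RInt (fun t => sin t * mehler_kernel1 s (a * sin t)) 0 (PI / 2).

Definition mehler2 (s a : R) : R :=
  2 / PI * RInt (fun t => sin t ^ 2 * mehler_kernel2 s (a * sin t)) 0 (PI / 2).

Lemma is_derive_mehler (s a : R) : is_derive (mehler s) a (mehler1 s a).
Proof.
unfold mehler, mehler1. apply is_derive_scal.
eapply is_derive_ext; [|replace (RInt (fun t => sin t * mehler_kernel1 s (a * sin t)) 0 (PI / 2))
  with (RInt (fun t => 1 * sin t * mehler_kernel1 s (a * sin t)) 0 (PI / 2))].
2:{ apply (is_derive_RInt_comp_sin (fun _ => 1)).
    - intros t. apply continuity_pt_const. intros x y; reflexivity.
    - apply is_derive_mehler_kernel.
    - apply mehler_kernel_continuous. }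
- intros t. simpl. apply RInt_ext. intros; apply Rmult_1_l.
- apply RInt_ext. intros; simpl; ring.
Qed.

Lemma is_derive_mehler1 (s a : R) : is_derive (mehler1 s) a (mehler2 s a).
Proof.
unfold mehler1, mehler2. apply is_derive_scal.
replace (RInt (fun t => sin t ^ 2 * mehler_kernel2 s (a * sin t)) 0 (PI / 2))
  with (RInt (fun t => sin t * sin t * mehler_kernel2 s (a * sin t)) 0 (PI / 2)).
- apply is_derive_RInt_comp_sin.
  + apply continuity_sin.
  + apply is_derive_mehler_kernel1.
  + apply mehler_kernel_continuous.
- apply RInt_ext. intros; simpl; ring.
Qed.

Lemma mehler_kernel1_0 (s : R) : mehler_kernel1 s 0 = 0.
Proof.
unfold mehler_kernel1. rewrite arcsinh_0, Rmult_0_r, sin_0. unfold Rdiv. ring.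
Qed.

(** Modulo [a] times the kernel's equation at [v = a sin t], the combined integrand is minus the
    derivative of [cos t * mehler_kernel1 s (a * sin t)], which vanishes at both ends:
    [cos (PI / 2) = 0] and [mehler_kernel1 s 0 = 0]. In [x = - a^2] this is the hypergeometric
    equation with [lam = 1/4 + s^2]. *)
Lemma mehler_ode (s a : R) :
  a * (1 + a ^ 2) * mehler2 s a + (1 + 3 * a ^ 2) * mehler1 s a + (1 + 4 * s ^ 2) * a * mehler s a = 0.
Proof.
pose (G := fun t => cos t * mehler_kernel1 s (a * sin t)).
pose (G1 := fun t => - sin t * mehler_kernel1 s (a * sin t) + cos t * (a * cos t * mehler_kernel2 s (a * sin t))).
pose proof (fun v => proj1 (mehler_kernel_continuous s v)) as C0.
pose proof (fun v => proj1 (proj2 (mehler_kernel_continuous s v))) as C1.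
pose proof (fun v => proj2 (proj2 (mehler_kernel_continuous s v))) as C2.
assert (HG : is_RInt G1 0 (PI / 2) (minus (G (PI / 2)) (G 0))).
{ apply (is_RInt_derive (V := R_CompleteNormedModule)).
  - intros t _. pose proof (is_derive_mehler_kernel1 s (a * sin t)) as K. unfold G, G1. auto_derive.
    + eexists; exact K.
    + rewrite (is_derive_unique (fun x : R => mehler_kernel1 s x) _ _ K). ring.
  - intros t _. apply continuity_pt_filterlim. unfold G1.
    apply continuity_pt_plus; apply continuity_pt_mult.
    + apply continuity_pt_opp, continuity_sin.
    + now apply continuity_pt_comp_sin.
    + apply continuity_cos.
    + apply continuity_pt_mult; [|now apply continuity_pt_comp_sin].
      apply continuity_pt_mult; [|apply continuity_cos].
      apply continuity_pt_const. intros x y; reflexivity. }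
assert (HG0 : minus (G (PI / 2)) (G 0) = 0).
{ unfold G, minus, plus, opp; simpl. rewrite cos_PI2, sin_0, Rmult_0_r, mehler_kernel1_0. ring. }
rewrite HG0 in HG.
pose (I0 := RInt (fun t => mehler_kernel s (a * sin t)) 0 (PI / 2)).
pose (I1 := RInt (fun t => sin t * mehler_kernel1 s (a * sin t)) 0 (PI / 2)).
pose (I2 := RInt (fun t => sin t ^ 2 * mehler_kernel2 s (a * sin t)) 0 (PI / 2)).
assert (E0 : is_RInt (fun t => mehler_kernel s (a * sin t)) 0 (PI / 2) I0).
{ apply (RInt_correct (V := R_CompleteNormedModule)), continuity_ex_RInt. intros t.
  now apply continuity_pt_comp_sin. }
assert (E1 : is_RInt (fun t => sin t * mehler_kernel1 s (a * sin t)) 0 (PI / 2) I1).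
{ apply (RInt_correct (V := R_CompleteNormedModule)), continuity_ex_RInt. intros t.
  apply continuity_pt_mult; [apply continuity_sin | now apply continuity_pt_comp_sin]. }
assert (E2 : is_RInt (fun t => sin t ^ 2 * mehler_kernel2 s (a * sin t)) 0 (PI / 2) I2).
{ apply (RInt_correct (V := R_CompleteNormedModule)), continuity_ex_RInt. intros t.
  apply continuity_pt_mult; [|now apply continuity_pt_comp_sin].
  apply (is_derive_continuity_pt _ _ (2 * sin t * cos t)). auto_derive; trivial. ring. }
assert (HS : is_RInt G1 0 (PI / 2)
  (- (a * (1 + a ^ 2) * I2 + (1 + 3 * a ^ 2) * I1 + (1 + 4 * s ^ 2) * a * I0))).
{ pose proof (is_RInt_scal _ _ _ (a * (1 + a ^ 2)) _ E2) as S2.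
  pose proof (is_RInt_scal _ _ _ (1 + 3 * a ^ 2) _ E1) as S1.
  pose proof (is_RInt_scal _ _ _ ((1 + 4 * s ^ 2) * a) _ E0) as S0.
  pose proof (is_RInt_opp _ _ _ _ (is_RInt_plus _ _ _ _ _ _ (is_RInt_plus _ _ _ _ _ _ S2 S1) S0)) as S.
  eapply is_RInt_ext; [|exact S]. intros t _.
  unfold opp, plus, scal; simpl. unfold mult; simpl. unfold G1.
  set (v := a * sin t).
  assert (Hk : (1 + v ^ 2) * mehler_kernel2 s v + 3 * v * mehler_kernel1 s v + (1 + 4 * s ^ 2) * mehler_kernel s v = 0).
  { unfold mehler_kernel2. field. nra. }
  assert (Hc : cos t * cos t = 1 - sin t * sin t) by (pose proof (sin2_cos2 t) as Q; unfold Rsqr in Q; lra).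
  replace (cos t * (a * cos t * mehler_kernel2 s v)) with (a * (cos t * cos t) * mehler_kernel2 s v) by ring.
  rewrite Hc. apply Rminus_diag_uniq. rewrite <- (Rmult_0_r (- a)), <- Hk.
  unfold v. ring. }
pose proof (is_RInt_unique _ _ _ _ HG) as U1. pose proof (is_RInt_unique _ _ _ _ HS) as U2.
unfold mehler, mehler1, mehler2. fold I0 I1 I2.
replace (_ + _ + _) with (2 / PI * (a * (1 + a ^ 2) * I2 + (1 + 3 * a ^ 2) * I1 + (1 + 4 * s ^ 2) * a * I0)) by ring.
apply Rmult_eq_0_compat_l. lra.
Qed.

Lemma mehler_0 (s : R) : mehler s 0 = 1.
Proof.
unfold mehler.
rewrite (RInt_ext _ (fun _ => 1)).
- rewrite RInt_const. unfold scal; simpl. unfold mult; simpl. pose proof PI_RGT_0. field. lra.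
- intros t _. unfold mehler_kernel. rewrite Rmult_0_l, arcsinh_0, Rmult_0_r, cos_0.
  replace (0 ^ 2 + 1) with 1 by ring. rewrite sqrt_1. apply Rdiv_1_r.
Qed.

Lemma mehler1_0 (s : R) : mehler1 s 0 = 0.
Proof.
unfold mehler1. rewrite (RInt_ext _ (fun _ => 0)).
- rewrite RInt_const. unfold scal; simpl. unfold mult; simpl. ring.
- intros t _. rewrite Rmult_0_l, mehler_kernel1_0. apply Rmult_0_r.
Qed.

(** * Identification of the conical function *)

(** Gauss coefficients in real form: for the conjugate parameters [1/2 + i s] and [1/2 - i s], the
    product of the factors of index j is [(j + 1/2)^2 + s^2]. *)
Fixpoint conical_coef (s : R) (k : nat) : R :=
  match k with
  | O => 1
  | S j => conical_coef s j * (((INR j + 1 / 2) ^ 2 + s ^ 2) / (INR j + 1) ^ 2)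
  end.

Lemma pochhammer_1 (k : nat) : pochhammer (RtoC 1) k = RtoC (INR (fact k)).
Proof.
induction k as [|k IH]; [reflexivity|].
change (fact (S k)) with (S k * fact k)%nat. rewrite mult_INR, S_INR. simpl pochhammer. rewrite IH.
rewrite <- RtoC_plus, <- RtoC_mult. f_equal. ring.
Qed.

Lemma gauss_coef_conical (s : R) (k : nat) :
  gauss_coef (RtoC (1 / 2) + Ci * RtoC s)%C (RtoC (1 / 2) - Ci * RtoC s)%C (RtoC 1) k
  = RtoC (conical_coef s k).
Proof.
set (a := (RtoC (1 / 2) + Ci * RtoC s)%C). set (b := (RtoC (1 / 2) - Ci * RtoC s)%C).
assert (H : (pochhammer a k * pochhammer b k)%C = RtoC (conical_coef s k * INR (fact k) ^ 2)).
{ induction k as [|k IH].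
  - simpl. rewrite <- RtoC_mult. f_equal. ring.
  - change (fact (S k)) with (S k * fact k)%nat. rewrite mult_INR, S_INR. simpl pochhammer.
    transitivity ((pochhammer a k * pochhammer b k) * ((a + RtoC (INR k)) * (b + RtoC (INR k))))%C.
    { ring. }
    rewrite IH.
    replace ((a + RtoC (INR k)) * (b + RtoC (INR k)))%C with (RtoC ((INR k + 1 / 2) ^ 2 + s ^ 2)).
    + rewrite <- RtoC_mult. f_equal. simpl conical_coef. pose proof (pos_INR k). field. lra.
    + unfold a, b. apply injective_projections; simpl; ring. }
unfold gauss_coef. rewrite H, pochhammer_1, <- RtoC_mult.
pose proof (INR_fact_neq_0 k) as Hf.
rewrite <- RtoC_div by (apply Rmult_integral_contrapositive; split; exact Hf).
f_equal. field. exact Hf.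
Qed.

Lemma conical_coef_pos (s : R) (k : nat) : 0 < conical_coef s k.
Proof.
induction k as [|k IH]; simpl; [lra|]. pose proof (pos_INR k).
apply Rmult_lt_0_compat; trivial. apply Rdiv_lt_0_compat; nra.
Qed.

Lemma conical_coef_radius (s : R) : CV_radius (conical_coef s) = 1.
Proof.
replace (Finite 1) with (Finite (/ 1)) by (f_equal; field).
apply CV_radius_finite_DAlembert; [|lra|].
- intros n. pose proof (conical_coef_pos s n). lra.
- apply is_lim_seq_ext with (fun n => 1 - / INR (S n) + (1 / 4 + s ^ 2) * (/ INR (S n) * / INR (S n))).
  { intros n. pose proof (conical_coef_pos s n). pose proof (pos_INR n). simpl conical_coef. rewrite S_INR.
    rewrite Rabs_pos_eq.
    - field. split; lra.
    - apply Rdiv_le_0_compat; trivial. apply Rmult_le_pos; [lra|].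
      apply Rdiv_le_0_compat; nra. }
  assert (Hinv : is_lim_seq (fun n => / INR (S n)) 0).
  { apply (is_lim_seq_incr_1 (fun n => / INR n)).
    apply (is_lim_seq_inv INR p_infty); [apply is_lim_seq_INR | discriminate]. }
  replace (Finite 1) with (Finite (1 - 0 + (1 / 4 + s ^ 2) * (0 * 0))) by (f_equal; ring).
  apply is_lim_seq_plus'.
  + apply is_lim_seq_minus'; [apply is_lim_seq_const | exact Hinv].
  + apply (is_lim_seq_scal_l _ _ (Finite (0 * 0))). now apply is_lim_seq_mult'.
Qed.

Lemma conical_coef_recurrence (s : R) : hyp_recurrence 0 1 (1 / 4 + s ^ 2) (conical_coef s).
Proof.
intros n. cbn [conical_coef]. rewrite S_INR. pose proof (pos_INR n). field. lra.
Qed.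

(* Both sides solve the same equation, singular at [0]; the energy of their
   difference vanishes at [0] and is nonincreasing. *)
Lemma conical_series_mehler (s a : R) : 0 <= a < 1 ->
  PSeries (conical_coef s) (- a ^ 2) = mehler s a.
Proof.
intros Ha.
destruct (Req_dec a 0) as [->|Hna].
{ rewrite mehler_0. replace (- 0 ^ 2) with 0 by ring. rewrite PSeries_0. reflexivity. }
set (c := conical_coef s).
set (Y := PSeries c). set (Y1 := PSeries (PS_derive c)). set (Y2 := PSeries (PS_derive (PS_derive c))).
assert (Hin : forall t, 0 <= t <= a -> Rbar_lt (Rabs (- t ^ 2)) (CV_radius c)).
{ intros t Ht. unfold c. rewrite conical_coef_radius. simpl. rewrite Rabs_Ropp, Rabs_pos_eq; nra. }
pose (d := fun t => Y (- t ^ 2) - mehler s t).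
pose (d1 := fun t => - 2 * t * Y1 (- t ^ 2) - mehler1 s t).
pose (d2 := fun t => - 2 * Y1 (- t ^ 2) + 4 * t ^ 2 * Y2 (- t ^ 2) - mehler2 s t).
assert (Hd : forall t, 0 <= t <= a -> is_derive d t (d1 t)).
{ intros t Ht. apply is_derive_minus_R; [|apply is_derive_mehler].
  pose proof (is_derive_PSeries c (- t ^ 2) (Hin t Ht)) as K.
  unfold Y. auto_derive; replace (- (t * (t * 1))) with (- t ^ 2) by ring.
  - eexists; exact K.
  - rewrite (is_derive_unique (fun x : R => PSeries c x) _ _ K). unfold Y1. ring. }
assert (Hd1 : forall t, 0 <= t <= a -> is_derive d1 t (d2 t)).
{ intros t Ht. apply is_derive_minus_R; [|apply is_derive_mehler1].
  pose proof (is_derive_PSeries (PS_derive c) (- t ^ 2)) as K.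
  rewrite CV_radius_derive in K. specialize (K (Hin t Ht)).
  unfold Y1. auto_derive; replace (- (t * (t * 1))) with (- t ^ 2) by ring.
  - eexists; exact K.
  - rewrite (is_derive_unique (fun x : R => PSeries (PS_derive c) x) _ _ K). unfold Y2. ring. }
assert (Hode : forall t, 0 <= t <= a ->
  t * ((1 + t ^ 2) * d2 t) = - ((1 + 3 * t ^ 2) * d1 t + (1 + 4 * s ^ 2) * t * d t)).
{ intros t Ht. pose proof (mehler_ode s t) as M.
  pose proof (PSeries_hyp_ode 0 1 (1 / 4 + s ^ 2) c (- t ^ 2) (conical_coef_recurrence s) (Hin t Ht)) as P.
  fold Y Y1 Y2 in P. unfold d, d1, d2.
  assert (Q : (-4 * t) * ((0 + 1 * - t ^ 2 - (- t ^ 2) ^ 2) * Y2 (- t ^ 2) + (1 - 2 * - t ^ 2) * Y1 (- t ^ 2))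
    = (-4 * t) * ((1 / 4 + s ^ 2) * Y (- t ^ 2))) by (f_equal; exact P).
  clear P. lra. }
(* The weights cancel the products [d * d1]: what remains is
   [t * E1 t = - 2 (1 + 2 t^2) * d1 t ^ 2], so the singular term only dissipates. *)
pose (E := fun t => (1 + t ^ 2) * d1 t ^ 2 + (1 + 4 * s ^ 2) * d t ^ 2).
pose (E1 := fun t => 2 * t * d1 t ^ 2 + 2 * (1 + t ^ 2) * d1 t * d2 t + 2 * (1 + 4 * s ^ 2) * d t * d1 t).
assert (HE : forall t, 0 <= t <= a -> is_derive E t (E1 t)).
{ intros t Ht. pose proof (Hd t Ht) as D1. pose proof (Hd1 t Ht) as D2. unfold E, E1.
  auto_derive.
  - repeat split; eexists; eassumption.
  - rewrite (is_derive_unique (fun x : R => d x) _ _ D1), (is_derive_unique (fun x : R => d1 x) _ _ D2). ring. }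
assert (E0 : E 0 = 0).
{ unfold E, d, d1. rewrite mehler_0, mehler1_0. replace (- 0 ^ 2) with 0 by ring.
  unfold Y. rewrite PSeries_0. change (c 0%nat) with 1. ring. }
destruct (MVT_cor2 E E1 0 a) as (m & Hm1 & Hm2).
{ lra. }
{ intros t Ht. apply is_derive_Reals, HE, Ht. }
assert (HE1 : E1 m <= 0).
{ apply Rmult_le_reg_l with m; [lra|]. rewrite Rmult_0_r.
  replace (m * E1 m) with (2 * m ^ 2 * d1 m ^ 2 + 2 * d1 m * (m * ((1 + m ^ 2) * d2 m))
     + 2 * (1 + 4 * s ^ 2) * m * d m * d1 m) by (unfold E1; ring).
  rewrite Hode by lra.
  replace (_ + _ + _) with (- (2 * (1 + 2 * m ^ 2) * d1 m ^ 2)) by ring.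
  pose proof (pow2_ge_0 (d1 m)). pose proof (pow2_ge_0 m). nra. }
assert (HEa : E a <= 0) by (rewrite E0 in Hm1; nra).
assert (Hda : d a = 0).
{ unfold E in HEa. pose proof (pow2_ge_0 (d1 a)). pose proof (pow2_ge_0 (d a)).
  pose proof (pow2_ge_0 a). pose proof (pow2_ge_0 s).
  assert (0 <= a ^ 2 * d1 a ^ 2) by (apply Rmult_le_pos; trivial).
  assert (0 <= s ^ 2 * d a ^ 2) by (apply Rmult_le_pos; trivial).
  assert (Hz : d a ^ 2 = 0) by lra. nra. }
unfold d in Hda. lra.
Qed.

(** The integral covers all negative [x] and the series covers [[0, 1)]; the two agree on [(-1, 0)],
    so the gluing at 0 is harmless. *)
Definition conical (s x : R) : R :=
  if Rlt_dec x 0 then mehler s (sqrt (- x)) else PSeries (conical_coef s) x.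

Lemma conical_series (s x : R) : Rabs x < 1 -> conical s x = PSeries (conical_coef s) x.
Proof.
intros Hx. unfold conical. destruct (Rlt_dec x 0) as [Hn|]; trivial.
rewrite <- conical_series_mehler.
- f_equal. rewrite pow2_sqrt; lra.
- rewrite Rabs_left in Hx by lra. split; [apply sqrt_pos|].
  rewrite <- sqrt_1. apply sqrt_lt_1; lra.
Qed.

Lemma real_analytic_at_ext (f g : R -> R) (x0 r : R) : 0 < r ->
  (forall x, Rabs (x - x0) < r -> f x = g x) -> real_analytic_at g x0 -> real_analytic_at f x0.
Proof.
intros Hr Hfg (u & r' & Hr' & Hu). exists u, (Rmin r r'). split; [now apply Rmin_pos|].
intros x Hx. pose proof (Rmin_l r r'). pose proof (Rmin_r r r').
rewrite Hfg by lra. apply Hu. lra.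
Qed.

Lemma conical_analytic (s x0 : R) : x0 < 1 -> real_analytic_at (conical s) x0.
Proof.
intros Hx0.
destruct (Rlt_dec (-1) x0) as [Hm|Hm].
- set (r := 1 - Rabs x0).
  assert (Ha : Rabs x0 < 1) by (apply Rabs_def1; lra).
  assert (Hin : forall x, Rabs (x - x0) < r -> Rabs x < 1).
  { intros x Hx. replace x with (x0 + (x - x0)) by ring.
    eapply Rle_lt_trans; [apply Rabs_triang|]. unfold r in Hx. lra. }
  apply real_analytic_at_ext with (PSeries (conical_coef s)) r; [unfold r; lra| |].
  { intros x Hx. apply conical_series, Hin, Hx. }
  assert (Hcv : forall x, Rabs (x - x0) < r -> Rbar_lt (Rabs x) (CV_radius (conical_coef s))).
  { intros x Hx. rewrite conical_coef_radius. apply Hin, Hx. }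
  destruct (Req_dec x0 0) as [->|Hn].
  (* At the singular point 0 the equation gives no expansion; the Gauss series is its own. *)
  + exists (conical_coef s), r. split; [unfold r; lra|]. intros x Hx.
    rewrite Rminus_0_r. apply PSeries_correct, CV_radius_inside, Hcv, Hx.
  + apply (hyp_ode_analytic (1 / 4 + s ^ 2) _ (PSeries (PS_derive (conical_coef s)))
     (PSeries (PS_derive (PS_derive (conical_coef s)))) x0 r); trivial; [unfold r; lra | lra | | |]; intros x Hx.
    * apply is_derive_PSeries, Hcv, Hx.
    * apply is_derive_PSeries. rewrite CV_radius_derive. apply Hcv, Hx.
    * rewrite <- (PSeries_hyp_ode 0 1 (1 / 4 + s ^ 2) _ x (conical_coef_recurrence s) (Hcv x Hx)). ring.
- assert (Hneg : forall x, Rabs (x - x0) < 1 / 2 -> x < 0).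
  { intros x Hx. apply Rabs_def2 in Hx. lra. }
  apply real_analytic_at_ext with (fun x => mehler s (sqrt (- x))) (1 / 2); [lra| |].
  { intros x Hx. unfold conical. destruct (Rlt_dec x 0) as [|N]; trivial. destruct (N (Hneg x Hx)). }
  assert (Hs : forall x, x < 0 -> 0 < sqrt (- x) /\ - sqrt (- x) ^ 2 = x).
  { intros x Hx. split; [apply sqrt_lt_R0; lra | rewrite pow2_sqrt; lra]. }
  apply (hyp_ode_analytic (1 / 4 + s ^ 2) _
    (fun x => - mehler1 s (sqrt (- x)) / (2 * sqrt (- x)))
    (fun x => mehler2 s (sqrt (- x)) / (4 * sqrt (- x) ^ 2) - mehler1 s (sqrt (- x)) / (4 * sqrt (- x) ^ 3))
    x0 (1 / 2)); [lra | lra | lra | | |]; intros x Hx; specialize (Hneg x Hx); destruct (Hs x Hneg) as [Hp Hq].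
  + pose proof (is_derive_mehler s (sqrt (- x))) as K. auto_derive.
    * repeat split; [eexists; exact K | lra].
    * rewrite (is_derive_unique (fun x : R => mehler s x) _ _ K). field. lra.
  + pose proof (is_derive_mehler1 s (sqrt (- x))) as K. auto_derive.
    * repeat split; [eexists; exact K | lra | lra | lra].
    * rewrite (is_derive_unique (fun x : R => mehler1 s x) _ _ K). field. lra.
  + pose proof (mehler_ode s (sqrt (- x))) as M. revert Hp Hq M.
    generalize (sqrt (- x)). intros a Hp <- M.
    transitivity (- / (4 * a) * (a * (1 + a ^ 2) * mehler2 s a + (1 + 3 * a ^ 2) * mehler1 s a)).
    * field. lra.
    * replace (a * (1 + a ^ 2) * mehler2 s a + (1 + 3 * a ^ 2) * mehler1 s a)
       with (- ((1 + 4 * s ^ 2) * a * mehler s a)) by lra. field. lra.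
Qed.

Lemma is_pseries_RtoC (u : nat -> R) (x l : R) :
  is_pseries u x l -> is_pseries (V := C_R_NormedModule) (fun n => RtoC (u n)) x (RtoC l).
Proof.
intros H. apply is_pseries_C_iff. split; [exact H|]. simpl.
apply is_pseries_R.
apply is_series_ext with (fun _ => 0); [intros n; simpl; ring|].
unfold is_series. apply filterlim_ext with (fun _ => 0); [|apply filterlim_const].
intros n. rewrite sum_n_const. ring.
Qed.

Lemma analytic_at_Re_Im (F : R -> C) (x0 : R) : analytic_at F x0 ->
  real_analytic_at (fun x => Re (F x)) x0 /\ real_analytic_at (fun x => Im (F x)) x0.
Proof.
intros (u & r & Hr & Hu). split.
- exists (fun n => Re (u n)), r. split; trivial. intros x Hx. now apply is_pseries_C_iff, Hu.
- exists (fun n => Im (u n)), r. split; trivial. intros x Hx. now apply is_pseries_C_iff, Hu.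
Qed.

Lemma real_analytic_at_minus (f g : R -> R) (x0 : R) :
  real_analytic_at f x0 -> real_analytic_at g x0 -> real_analytic_at (fun x => f x - g x) x0.
Proof.
intros (u & r & Hr & Hu) (v & r' & Hr' & Hv).
exists (PS_minus u v), (Rmin r r'). split; [now apply Rmin_pos|].
intros x Hx. pose proof (Rmin_l r r'). pose proof (Rmin_r r r').
apply (is_pseries_minus (K := R_AbsRing) (V := R_NormedModule)); [apply Hu | apply Hv]; lra.
Qed.

(** On [(-1, 1)] both functions are sums of one series; for [x <= -1] the identity theorem is
    applied to the real and imaginary parts of the difference. This pins down the function chosen by
    [epsilon] in [hyp2F1] on [x < 1]. *)
Lemma is_hyp2F1_unique (a b c : C) (F G : R -> C) (x : R) :
  is_hyp2F1 a b c F -> is_hyp2F1 a b c G -> x < 1 -> F x = G x.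
Proof.
intros [F1 F2] [G1 G2] Hx.
assert (Hin : forall t, Rabs t < 1 -> Re (F t) - Re (G t) = 0 /\ Im (F t) - Im (G t) = 0).
{ intros t Ht. specialize (F1 t Ht). specialize (G1 t Ht).
  apply is_pseries_C_iff in F1, G1. destruct F1 as [A1 A2], G1 as [B1 B2].
  apply is_pseries_unique in A1, A2, B1, B2. rewrite <- A1, <- A2, <- B1, <- B2. split; ring. }
assert (Hout : Re (F x) - Re (G x) = 0 /\ Im (F x) - Im (G x) = 0).
{ destruct (Rlt_dec (-1) x) as [H|H].
  - apply Hin. apply Rabs_def1; lra.
  - split.
    + apply (analytic_identity (fun t => Re (F t) - Re (G t)) 1 0 (1 / 2)); [lra| | |lra].
      * intros t Ht. apply real_analytic_at_minus; apply analytic_at_Re_Im; [apply F2 | apply G2]; exact Ht.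
      * intros t Ht. apply Hin. apply Rabs_def1; lra.
    + apply (analytic_identity (fun t => Im (F t) - Im (G t)) 1 0 (1 / 2)); [lra| | |lra].
      * intros t Ht. apply real_analytic_at_minus; apply analytic_at_Re_Im; [apply F2 | apply G2]; exact Ht.
      * intros t Ht. apply Hin. apply Rabs_def1; lra. }
destruct (F x) as [f1 f2], (G x) as [g1 g2]. simpl in Hout. f_equal; lra.
Qed.

Lemma conical_is_hyp2F1 (s : R) :
  is_hyp2F1 (RtoC (1 / 2) + Ci * RtoC s)%C (RtoC (1 / 2) - Ci * RtoC s)%C (RtoC 1)
    (fun x => RtoC (conical s x)).
Proof.
split.
- intros x Hx. unfold is_pseries.
  apply is_series_ext with (fun k => scal (pow_n x k) (RtoC (conical_coef s k) : C_R_NormedModule)).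
  { intros k. now rewrite gauss_coef_conical. }
  apply is_pseries_RtoC. rewrite conical_series by exact Hx.
  apply PSeries_correct, CV_radius_inside. rewrite conical_coef_radius. exact Hx.
- intros x Hx. destruct (conical_analytic s x Hx) as (u & r & Hr & Hu).
  exists (fun n => RtoC (u n)), r. split; trivial. intros t Ht. now apply is_pseries_RtoC, Hu.
Qed.

Lemma conicalP_mehler (s y : R) : 1 < y -> conicalP s y = RtoC (mehler s (sqrt ((y - 1) / 2))).
Proof.
intros Hy. unfold conicalP, hyp2F1.
rewrite (is_hyp2F1_unique _ _ _ _ _ ((1 - y) / 2)
  (epsilon_spec _ _ (ex_intro _ _ (conical_is_hyp2F1 s))) (conical_is_hyp2F1 s)) by lra.
unfold conical. destruct (Rlt_dec ((1 - y) / 2) 0); [|lra].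
do 3 f_equal. field.
Qed.

(** * Zeros of the conical function *)

(* What is left of [PI * a * mehler s a] once the exact derivative
   [cos t * (2 * a) * mehler_kernel s (a * sin t)] of
   [sin (2 * s * arcsinh (a * sin t)) / s] is taken out. *)
Definition mehler_remainder (s a : R) : R :=
  RInt (fun t => (1 - cos t) * (2 * a) * mehler_kernel s (a * sin t)) 0 (PI / 2).

(** Since [0 <= cos t <= 1], [(1 - cos t)^2 <= 1 - cos t ^ 2 = sin t ^ 2], so [a (1 - cos t)] is at
    most [a sin t]. The bound is uniform in [a], which is the gain from removing the exact
    derivative. *)
Lemma mehler_remainder_weight (a t : R) : 0 <= a -> 0 <= t <= PI / 2 ->
  0 <= (1 - cos t) * (2 * a) / sqrt ((a * sin t) ^ 2 + 1) <= 2.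
Proof.
intros Ha Ht. destruct (sqrt_sqr1 (a * sin t)) as [Hp Hs].
pose proof (COS_bound t) as [_ Hc1]. pose proof (cos_ge_0 t ltac:(lra) ltac:(lra)) as Hc0.
pose proof (sin2_cos2 t) as Hsc. unfold Rsqr in Hsc.
split.
- apply Rdiv_le_0_compat; trivial. apply Rmult_le_pos; lra.
- apply Rle_div_l; trivial.
  assert ((1 - cos t) * a <= sqrt ((a * sin t) ^ 2 + 1)); [|lra].
  apply Rsqr_incr_0; [|apply Rmult_le_pos; lra | lra]. unfold Rsqr. rewrite Hs.
  replace ((a * sin t) ^ 2) with (a * a * (sin t * sin t)) by ring.
  replace (sin t * sin t) with (1 - cos t * cos t) by lra.
  assert (0 <= a * a) by nra.
  assert (a * a * ((1 - cos t) * (1 - cos t)) <= a * a * (1 - cos t * cos t)) by (apply Rmult_le_compat_l; nra).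
  lra.
Qed.

Lemma mehler_remainder_integrable (s a : R) :
  ex_RInt (fun t => (1 - cos t) * (2 * a) * mehler_kernel s (a * sin t)) 0 (PI / 2).
Proof.
apply continuity_ex_RInt. intros t. apply continuity_pt_mult.
- apply (is_derive_continuity_pt _ _ (sin t * (2 * a))). auto_derive; trivial. ring.
- apply continuity_pt_comp_sin. apply mehler_kernel_continuous.
Qed.

Lemma mehler_remainder_bound (s a : R) : 0 <= a -> Rabs (mehler_remainder s a) <= PI.
Proof.
intros Ha. pose proof PI_RGT_0. replace PI with ((PI / 2 - 0) * 2) at 1 by field.
apply abs_RInt_le_const; [lra | apply mehler_remainder_integrable|].
intros t Ht. unfold mehler_kernel.
destruct (mehler_remainder_weight a t Ha Ht).
replace (_ * _) with ((1 - cos t) * (2 * a) / sqrt ((a * sin t) ^ 2 + 1) * cos (2 * s * arcsinh (a * sin t))).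
2:{ unfold Rdiv; ring. }
rewrite Rabs_mult, Rabs_pos_eq by lra.
assert (Rabs (cos (2 * s * arcsinh (a * sin t))) <= 1) by (apply Rabs_le, COS_bound).
pose proof (Rabs_pos (cos (2 * s * arcsinh (a * sin t)))). nra.
Qed.

Lemma cos_lipschitz (x y : R) : Rabs (cos x - cos y) <= Rabs (x - y).
Proof.
destruct (MVT_gen cos y x (fun t => - sin t)) as (c & _ & Hc).
- intros t _. auto_derive; trivial. ring.
- intros t _. apply continuity_cos.
- rewrite Hc, Rabs_mult, Rabs_Ropp.
  assert (Rabs (sin c) <= 1) by (apply Rabs_le, SIN_bound).
  pose proof (Rabs_pos (x - y)). nra.
Qed.

(** The phase [2 s arcsinh (a sin t)] has slope at most [2 arcsinh a] in [s], and the weight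
    integrates to at most [PI]. *)
Lemma mehler_remainder_lipschitz (s s' a : R) : 0 <= a ->
  Rabs (mehler_remainder s a - mehler_remainder s' a) <= 2 * arcsinh a * PI * Rabs (s - s').
Proof.
intros Ha. pose proof PI_RGT_0. unfold mehler_remainder.
rewrite <- (RInt_minus (V := R_CompleteNormedModule)) by apply mehler_remainder_integrable.
replace (2 * arcsinh a * PI * Rabs (s - s')) with ((PI / 2 - 0) * (2 * (2 * arcsinh a * Rabs (s - s')))) by field.
apply abs_RInt_le_const; [lra | apply (ex_RInt_minus (V := R_CompleteNormedModule)); apply mehler_remainder_integrable|].
intros t Ht. destruct (mehler_remainder_weight a t Ha Ht).
unfold mehler_kernel, minus, plus, opp; simpl.
match goal with |- Rabs ?x <= _ => replace x with ((1 - cos t) * (2 * a) / sqrt ((a * sin t) ^ 2 + 1) *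
 (cos (2 * s * arcsinh (a * sin t)) - cos (2 * s' * arcsinh (a * sin t)))) end.
2:{ simpl. unfold Rdiv; ring. }
rewrite Rabs_mult, Rabs_pos_eq by lra.
apply Rmult_le_compat; [lra | apply Rabs_pos | lra |].
eapply Rle_trans; [apply cos_lipschitz|].
replace (2 * s * arcsinh (a * sin t) - 2 * s' * arcsinh (a * sin t)) with (2 * arcsinh (a * sin t) * (s - s')) by ring.
rewrite Rabs_mult. apply Rmult_le_compat_r; [apply Rabs_pos|].
assert (Hs : 0 <= sin t) by (apply sin_ge_0; lra). pose proof (SIN_bound t).
assert (0 <= arcsinh (a * sin t)).
{ rewrite <- arcsinh_0. apply arcsinh_le. nra. }
assert (arcsinh (a * sin t) <= arcsinh a) by (apply arcsinh_le; nra).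
rewrite Rabs_pos_eq; lra.
Qed.

Lemma mehler_phase (s a : R) :
  s * PI * a * mehler s a = sin (2 * s * arcsinh a) + s * mehler_remainder s a.
Proof.
pose proof PI_RGT_0.
pose (k := fun t => mehler_kernel s (a * sin t)).
assert (Ck : forall t, continuity_pt k t) by (intros t; apply continuity_pt_comp_sin, mehler_kernel_continuous).
assert (Ek : is_RInt k 0 (PI / 2) (RInt k 0 (PI / 2))).
{ apply (RInt_correct (V := R_CompleteNormedModule)), continuity_ex_RInt, Ck. }
assert (Er : is_RInt (fun t => (1 - cos t) * (2 * a) * k t) 0 (PI / 2) (mehler_remainder s a)).
{ apply (RInt_correct (V := R_CompleteNormedModule)), mehler_remainder_integrable. }
assert (Es : is_RInt (fun t => 2 * s * a * cos t * k t) 0 (PI / 2)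
  (minus (sin (2 * s * arcsinh (a * sin (PI / 2)))) (sin (2 * s * arcsinh (a * sin 0))))).
{ apply (is_RInt_derive (V := R_CompleteNormedModule) (fun t => sin (2 * s * arcsinh (a * sin t)))).
  - intros t _. pose proof (is_derive_arcsinh (a * sin t)) as K. auto_derive; [eexists; exact K|].
    rewrite (is_derive_unique (fun x : R => arcsinh x) _ _ K). unfold k, mehler_kernel.
    destruct (sqrt_sqr1 (a * sin t)). field. lra.
  - intros t _. apply continuity_pt_filterlim. apply continuity_pt_mult; [|apply Ck].
    apply (is_derive_continuity_pt _ _ (- (2 * s * a * sin t))). auto_derive; trivial. ring. }
rewrite sin_PI2, sin_0, Rmult_0_r, Rmult_1_r, arcsinh_0, Rmult_0_r, sin_0 in Es.
pose proof (is_RInt_plus _ _ _ _ _ _ Es (is_RInt_scal _ _ _ s _ Er)) as S1.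
pose proof (is_RInt_scal _ _ _ (2 * s * a) _ Ek) as S2.
apply (is_RInt_unique (V := R_CompleteNormedModule)) in S1, S2.
assert (S : 2 * s * a * RInt k 0 (PI / 2) = sin (2 * s * arcsinh a) - 0 + s * mehler_remainder s a).
{ etransitivity; [symmetry; exact S2|]. etransitivity; [|exact S1].
  apply (RInt_ext (V := R_CompleteNormedModule)). intros t _. unfold plus, scal; simpl. unfold mult; simpl. ring. }
unfold mehler. fold k.
transitivity (2 * s * a * RInt k 0 (PI / 2)).
- field. lra.
- rewrite S. ring.
Qed.

(** * Zeros of a small perturbation of the sine *)

Lemma sin_ge_third (u : R) : 0 <= u <= PI / 2 -> u / 3 <= sin u.
Proof.
intros Hu. pose proof PI_4. pose proof PI_RGT_0.
destruct (sin_bound u 0) as [H1 _]; try lra.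
unfold sin_approx in H1. simpl in H1. unfold sin_term in H1. simpl in H1.
(* From [sin u >= u - u^3 / 6] and [u <= 2], the factor is at least [1 - 4/6]. *)
assert (u * u <= 4) by nra.
assert (0 <= u * (4 - u * u)) by (apply Rmult_le_pos; lra). lra.
Qed.

Lemma Rabs_sin_ge_third (u : R) : Rabs u <= PI / 2 -> Rabs u / 3 <= Rabs (sin u).
Proof.
intros Hu. destruct (Rle_dec 0 u) as [H|H].
- rewrite Rabs_pos_eq in * by lra. pose proof (sin_ge_third u ltac:(lra)).
  rewrite Rabs_pos_eq; lra.
- rewrite Rabs_left1 in * by lra. pose proof (sin_ge_third (- u) ltac:(lra)) as K.
  rewrite sin_neg in K. rewrite <- Rabs_Ropp, Rabs_pos_eq; lra.
Qed.

Lemma sin_increment (u v : R) : Rabs u <= 3 / 4 -> Rabs v <= 3 / 4 ->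
  Rabs (u - v) / 2 <= Rabs (sin u - sin v).
Proof.
intros Hu Hv.
destruct (MVT_gen sin v u cos) as (c & Hc & E).
- intros t _. auto_derive; trivial. ring.
- intros t _. apply continuity_sin.
- rewrite E, Rabs_mult.
  assert (Hc' : Rabs c <= 3 / 4).
  { apply Rabs_le_between in Hu, Hv. apply Rabs_le_between.
    revert Hc. unfold Rmin, Rmax. destruct (Rle_dec v u); lra. }
  assert (1 / 2 <= cos c).
  { apply Rabs_le_between in Hc'. pose proof PI2_1.
    destruct (cos_bound c 0) as [K _]; try lra.
    unfold cos_approx in K. simpl in K. unfold cos_term in K. simpl in K. nra. }
  rewrite (Rabs_pos_eq (cos c)) by lra. pose proof (Rabs_pos (u - v)). nra.
Qed.

Lemma sin_shift (m : nat) (u : R) : sin (INR m * PI + u) = cos (INR m * PI) * sin u.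
Proof.
rewrite sin_plus. rewrite (sin_eq_0_1 (INR m * PI)); [ring|].
exists (Z.of_nat m). now rewrite <- INR_IZR_INZ.
Qed.

Lemma Rabs_cos_INR_PI (m : nat) : Rabs (cos (INR m * PI)) = 1.
Proof.
pose proof (sin2_cos2 (INR m * PI)) as H. unfold Rsqr in H.
rewrite (sin_eq_0_1 (INR m * PI)) in H.
- set (c := cos (INR m * PI)) in *. unfold Rabs. destruct (Rcase_abs c); nra.
- exists (Z.of_nat m). now rewrite <- INR_IZR_INZ.
Qed.

(** The bound in size localises zeros near multiples of [PI], the bound by [eps * x] excludes zeros
    near 0, and the slope bound gives continuity and uniqueness. With [eps <= 1/4] zeros move by at
    most [3/4], where the sine has slope at least [1/2], more than that of [P]. *)
Definition small_perturbation (n : nat) (eps : R) (P : R -> R) : Prop :=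
  let b := (INR n + 1 / 2) * PI in
  0 <= eps <= 1 / 4 /\
  (forall x, 0 < x <= b -> Rabs (P x) <= eps) /\
  (forall x, 0 < x <= b -> Rabs (P x) <= eps * x) /\
  (forall x y, 0 < x <= b -> 0 < y <= b -> Rabs (P x - P y) <= eps * Rabs (x - y)).

Lemma strip_in_domain (n m : nat) (u : R) : (1 <= m <= n)%nat -> Rabs u <= PI / 2 ->
  0 < INR m * PI + u <= (INR n + 1 / 2) * PI.
Proof.
intros [H1 H2] Hu. apply le_INR in H1, H2. simpl in H1. apply Rabs_le_between in Hu.
pose proof PI_RGT_0. split; nra.
Qed.

Lemma perturbed_sine_no_zero (n : nat) (eps : R) (P : R -> R) (x : R) :
  small_perturbation n eps P -> 0 < x <= PI / 2 -> sin x + P x <> 0.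
Proof.
intros HS. pose proof HS as (Heps & HP1 & HPx & HPl). cbv zeta in HP1, HPx, HPl.
intros Hx. pose proof PI_RGT_0. pose proof (pos_INR n).
assert (Hb : 0 < x <= (INR n + 1 / 2) * PI) by nra.
pose proof (HPx x Hb) as K. apply Rabs_le_between in K.
pose proof (sin_ge_third x ltac:(lra)). nra.
Qed.

Lemma perturbed_sine_zero_near (n : nat) (eps : R) (P : R -> R) (m : nat) (u : R) :
  small_perturbation n eps P -> (1 <= m <= n)%nat -> Rabs u <= PI / 2 ->
  sin (INR m * PI + u) + P (INR m * PI + u) = 0 -> Rabs u <= 3 * eps.
Proof.
intros HS. pose proof HS as (Heps & HP1 & HPx & HPl). cbv zeta in HP1, HPx, HPl.
intros Hm Hu Hg. pose proof (HP1 _ (strip_in_domain n m u Hm Hu)) as K.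
rewrite sin_shift in Hg.
assert (E : Rabs (sin u) = Rabs (P (INR m * PI + u))).
{ rewrite <- (Rmult_1_l (Rabs (sin u))), <- (Rabs_cos_INR_PI m), <- Rabs_mult, <- Rabs_Ropp.
  f_equal. lra. }
pose proof (Rabs_sin_ge_third u Hu). lra.
Qed.

Lemma perturbed_sine_zero_unique (n : nat) (eps : R) (P : R -> R) (m : nat) (u v : R) :
  small_perturbation n eps P -> (1 <= m <= n)%nat ->
  Rabs u <= PI / 2 -> Rabs v <= PI / 2 ->
  sin (INR m * PI + u) + P (INR m * PI + u) = 0 -> sin (INR m * PI + v) + P (INR m * PI + v) = 0 -> u = v.
Proof.
intros HS. pose proof HS as (Heps & HP1 & HPx & HPl). cbv zeta in HP1, HPx, HPl.
intros Hm Hu Hv Gu Gv.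
pose proof (perturbed_sine_zero_near n eps P m u HS Hm Hu Gu). pose proof (perturbed_sine_zero_near n eps P m v HS Hm Hv Gv).
pose proof (HPl _ _ (strip_in_domain n m u Hm Hu) (strip_in_domain n m v Hm Hv)) as K.
replace (INR m * PI + u - (INR m * PI + v)) with (u - v) in K by ring.
rewrite sin_shift in Gu, Gv.
assert (E : Rabs (sin u - sin v) = Rabs (P (INR m * PI + u) - P (INR m * PI + v))).
{ rewrite <- (Rmult_1_l (Rabs (sin u - sin v))), <- (Rabs_cos_INR_PI m), <- Rabs_mult, <- Rabs_Ropp.
  f_equal. lra. }
pose proof (sin_increment u v ltac:(lra) ltac:(lra)). pose proof (Rabs_pos (u - v)).
apply Rminus_diag_uniq. apply NNPP. intros N. apply Rabs_pos_lt in N. nra.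
Qed.

Lemma perturbed_sine_zero_ex (n : nat) (eps : R) (P : R -> R) (m : nat) :
  small_perturbation n eps P -> (1 <= m <= n)%nat ->
  exists u, Rabs u <= PI / 2 /\ sin (INR m * PI + u) + P (INR m * PI + u) = 0.
Proof.
intros HS. pose proof HS as (Heps & HP1 & HPx & HPl). cbv zeta in HP1, HPx, HPl.
intros Hm. pose proof PI_RGT_0. set (k := cos (INR m * PI)).
assert (Hk : Rabs k = 1) by apply Rabs_cos_INR_PI.
assert (Hk2 : k * k = 1).
{ rewrite <- (Rabs_pos_eq (k * k)) by nra. rewrite Rabs_mult, Hk. ring. }
(* Multiplying by [k], which is 1 or -1, fixes the sign of the sine, so [f] goes from negative to
   positive for every [m]. *)
pose (f := fun u => sin u + k * P (INR m * PI + u)).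
assert (Hd : forall u, - (PI / 2) <= u <= PI / 2 -> 0 < INR m * PI + u <= (INR n + 1 / 2) * PI).
{ intros u Hu. apply strip_in_domain; trivial. now apply Rabs_le. }
assert (HkP : forall u, - (PI / 2) <= u <= PI / 2 -> Rabs (k * P (INR m * PI + u)) <= 1 / 4).
{ intros u Hu. rewrite Rabs_mult, Hk. pose proof (HP1 _ (Hd u Hu)). lra. }
(* [P] is only controlled on the strip, hence the clamping of the argument. *)
pose (cl := fun u => Rmax (- (PI / 2)) (Rmin u (PI / 2))).
assert (Hcl : forall u, - (PI / 2) <= cl u <= PI / 2).
{ intros u. unfold cl, Rmax, Rmin. destruct (Rle_dec u (PI / 2)); destruct (Rle_dec _ _); lra. }
assert (Hcl_id : forall u, - (PI / 2) <= u <= PI / 2 -> cl u = u).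
{ intros u Hu. unfold cl, Rmax, Rmin. destruct (Rle_dec u (PI / 2)); destruct (Rle_dec _ _); lra. }
assert (Hcll : forall u v, Rabs (cl u - cl v) <= Rabs (u - v)).
{ intros u v. unfold cl, Rmax, Rmin, Rabs.
  destruct (Rle_dec u (PI / 2)); destruct (Rle_dec v (PI / 2)); repeat destruct (Rle_dec _ _);
  repeat destruct (Rcase_abs _); lra. }
assert (Hcont : continuity (fun u => f (cl u))).
{ intros u. unfold f.
  assert (Cl : continuity_pt cl u).
  { intros e He. exists e. split; trivial. intros v [_ Hv]. simpl in *. unfold R_dist in *.
    eapply Rle_lt_trans; [apply Hcll | exact Hv]. }
  apply continuity_pt_plus.
  - apply (continuity_pt_comp cl sin); [exact Cl | apply continuity_sin].
  - intros e He. exists e. split; trivial. intros v [_ Hv]. simpl in *. unfold R_dist in *.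
    rewrite <- Rmult_minus_distr_l, Rabs_mult, Hk.
    pose proof (HPl _ _ (Hd _ (Hcl v)) (Hd _ (Hcl u))) as K.
    replace (INR m * PI + cl v - (INR m * PI + cl u)) with (cl v - cl u) in K by ring.
    pose proof (Hcll v u). pose proof (Rabs_pos (cl v - cl u)). nra. }
destruct (IVT (fun u => f (cl u)) (- (PI / 2)) (PI / 2)) as (u & Hu & Hf); trivial.
- lra.
- rewrite Hcl_id by lra. unfold f. rewrite sin_neg, sin_PI2.
  pose proof (HkP (- (PI / 2)) ltac:(lra)) as K. apply Rabs_le_between in K. lra.
- rewrite Hcl_id by lra. unfold f. rewrite sin_PI2.
  pose proof (HkP (PI / 2) ltac:(lra)) as K. apply Rabs_le_between in K. lra.
- exists u. split; [now apply Rabs_le|]. rewrite Hcl_id in Hf by trivial.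
  rewrite sin_shift. fold k.
  replace (P (INR m * PI + u)) with (k * k * P (INR m * PI + u)) by (rewrite Hk2; ring).
  unfold f in Hf. rewrite <- (Rmult_0_r k), <- Hf. ring.
Qed.

(** The window up to [PI / 2] is empty, and each further window of length [PI] contributes exactly
    one zero. *)
Lemma perturbed_sine_count (n : nat) (eps : R) (P : R -> R) (m : nat) :
  small_perturbation n eps P -> (m <= n)%nat ->
  exists l : list R, NoDup l /\ length l = m /\
    forall x, In x l <-> (0 < x <= (INR m + 1 / 2) * PI /\ sin x + P x = 0).
Proof.
intros HS. pose proof HS as (Heps & HP1 & HPx & HPl). cbv zeta in HP1, HPx, HPl.
pose proof PI_RGT_0 as HPI.
induction m as [|m IH]; intros Hm.
- exists nil. split; [constructor | split; [reflexivity|]]. intros x. split; [intros []|].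
  intros [Hx Hg]. exfalso. apply (perturbed_sine_no_zero n eps P x HS); trivial. simpl in Hx. lra.
- destruct IH as (l & Hl1 & Hl2 & Hl3); [lia|].
  assert (Hm' : (1 <= S m <= n)%nat) by lia.
  destruct (perturbed_sine_zero_ex n eps P (S m) HS Hm') as (u & Hu & Hg).
  pose proof (perturbed_sine_zero_near n eps P (S m) u HS Hm' Hu Hg) as Hu3.
  pose proof PI2_1. pose proof (strip_in_domain n (S m) u Hm' Hu) as Hin.
  (* [3 * eps <= 3/4 < PI / 2] keeps the new zero off the edge shared with the previous window, so
     it is not already in [l]. *)
  assert (Huu : - (PI / 2) < u < PI / 2) by (apply Rabs_le_between in Hu3; lra).
  set (z := INR (S m) * PI + u) in *.
  exists (z :: l). split; [|split].
  + constructor; trivial. intros K. apply Hl3 in K. unfold z in K. rewrite S_INR in K. nra.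
  + simpl. now rewrite Hl2.
  + intros x. simpl In. rewrite Hl3. rewrite S_INR. split.
    * intros [<-|[K1 K2]]; split; trivial; [|lra]. unfold z. rewrite S_INR. unfold z in Hin. rewrite S_INR in Hin.  lra.
    * intros [Hx Gx]. destruct (Rle_dec x ((INR m + 1 / 2) * PI)) as [K|K]; [right; lra|left].
      unfold z. replace x with (INR (S m) * PI + (x - INR (S m) * PI)) in Gx |- * by ring.
      f_equal. apply (perturbed_sine_zero_unique n eps P (S m) _ _ HS); trivial.
      apply Rabs_le. rewrite S_INR. lra.
Qed.

Lemma perturbed_sine_nth_zero (n : nat) (eps : R) (P : R -> R) :
  small_perturbation n eps P -> (1 <= n)%nat ->
  exists z, Rabs (z - INR n * PI) <= 3 * eps /\ is_nth_pos_zero (fun x => RtoC (sin x + P x)) n z.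
Proof.
intros HS. pose proof HS as (Heps & HP1 & HPx & HPl). cbv zeta in HP1, HPx, HPl.
intros Hn. pose proof PI_RGT_0 as HPI. assert (Hnn : (1 <= n <= n)%nat) by lia.
destruct (perturbed_sine_zero_ex n eps P n HS Hnn) as (u & Hu & Hg).
pose proof (perturbed_sine_zero_near n eps P n u HS Hnn Hu Hg) as Hu3.
destruct (perturbed_sine_count n eps P n HS (le_n n)) as (l & Hl1 & Hl2 & Hl3).
destruct (strip_in_domain n n u Hnn Hu) as [Hz1 Hz2].
exists (INR n * PI + u). split.
{ replace (_ - _) with u by ring. exact Hu3. }
split; [exact Hz1|]. split; [now rewrite Hg|].
exists l. split; trivial. split; trivial. intros x. rewrite Hl3. split.
- intros [Hx Gx]. rewrite Gx. split; trivial. split; [lra|].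
  (* A zero beyond the n-th one but before the end of the window would lie in the same strip, where
     the zero is unique. *)
  apply Rnot_lt_le. intros Hlt.
  assert (x - INR n * PI = u); [|lra].
  apply Rabs_le_between in Hu.
  apply (perturbed_sine_zero_unique n eps P n _ _ HS); trivial.
  + apply Rabs_le. lra.
  + now apply Rabs_le.
  + replace (INR n * PI + (x - INR n * PI)) with x by ring. exact Gx.
- intros [Hx Gx]. apply RtoC_inj in Gx. split; trivial. lra.
Qed.

Lemma is_nth_pos_zero_scale (f : R -> C) (n : nat) (z r : R) : 0 < r ->
  is_nth_pos_zero (fun x => f (x / r)) n z -> is_nth_pos_zero f n (z / r).
Proof.
intros Hr (Hz & Hf & l & Hl1 & Hl2 & Hl3).
assert (Hri : 0 < / r) by now apply Rinv_0_lt_compat.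
split; [now apply Rdiv_lt_0_compat | split; trivial].
exists (map (fun x => x / r) l). split; [|split].
- apply NoDup_map_NoDup_ForallPairs; trivial. intros x y _ _ E. unfold Rdiv in E.
  apply Rmult_eq_reg_r with (/ r); lra.
- now rewrite length_map.
- intros x. rewrite in_map_iff. split.
  + intros (y & <- & Hy). apply Hl3 in Hy. destruct Hy as [[Y1 Y2] Y3]. repeat split; trivial.
    * now apply Rdiv_lt_0_compat.
    * apply Rmult_le_compat_r; lra.
  + intros [[X1 X2] X3]. exists (x * r). assert (E : x * r / r = x) by (field; lra).
    split; trivial. apply Hl3. rewrite E. repeat split; trivial.
    * now apply Rmult_lt_0_compat.
    * apply Rle_div_r; lra.
Qed.

Lemma is_nth_pos_zero_ext (f g : R -> C) (n : nat) (z : R) :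
  (forall x, 0 < x -> (f x = RtoC 0 <-> g x = RtoC 0)) ->
  is_nth_pos_zero f n z -> is_nth_pos_zero g n z.
Proof.
intros H (Hz & Hf & l & Hl1 & Hl2 & Hl3).
split; trivial. split; [now apply H|]. exists l. split; trivial. split; trivial.
intros x. rewrite Hl3. split; intros [X1 X2]; split; trivial; apply H; tauto.
Qed.

(** If [z < z'], the list of [z'] contains [z'] and all n zeros up to [z], one too many. This ties
    the [epsilon] in [s_zero] to the zero constructed here. *)
Lemma is_nth_pos_zero_unique (f : R -> C) (n : nat) (z z' : R) :
  is_nth_pos_zero f n z -> is_nth_pos_zero f n z' -> z = z'.
Proof.
assert (W : forall z z', is_nth_pos_zero f n z -> is_nth_pos_zero f n z' -> ~ z < z').
{ clear z z'. intros z z' (Hz & Hf & l & Hl1 & Hl2 & Hl3) (Hz' & Hf' & l' & Hl1' & Hl2' & Hl3') Hlt.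
  assert (K : (length (z' :: l) <= length l')%nat); [|simpl in K; lia].
  apply NoDup_incl_length.
  - constructor; trivial. intros K. apply Hl3 in K. lra.
  - intros x [<-|Hx]; apply Hl3'.
    + split; trivial. lra.
    + apply Hl3 in Hx. split; [lra | tauto]. }
intros H H'. destruct (Rtotal_order z z') as [L|[E|L]]; trivial; exfalso.
- exact (W z z' H H' L).
- exact (W z' z H' H L).
Qed.

Lemma mehler_nth_zero (n : nat) : (1 <= n)%nat ->
  exists M r0, 0 < r0 /\ forall a, 0 < a -> r0 <= 2 * arcsinh a ->
    exists z, is_nth_pos_zero (fun s => RtoC (mehler s a)) n z /\
      Rabs (z - INR n * PI / (2 * arcsinh a)) <= M / (2 * arcsinh a) ^ 2.
Proof.
intros Hn. pose proof PI_RGT_0 as HPI. pose proof (pos_INR n) as Hn0.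
(* [c / r] bounds the slope of [x / r * E (x / r)]: [PI / r] comes from the first factor,
   [b * PI / r] from the second. Then [r >= 4 * c] gives [eps <= 1/4], and [3 * c] comes from the
   displacement [3 * eps], divided by [r] on returning to [s]. *)
set (b := (INR n + 1 / 2) * PI). set (c := (1 + b) * PI).
assert (Hb : 0 < b) by (apply Rmult_lt_0_compat; lra).
assert (Hc : 0 < c) by (apply Rmult_lt_0_compat; lra).
exists (3 * c), (4 * c). split; [lra|]. intros a Ha Hr.
set (r := 2 * arcsinh a) in *. assert (Hr0 : 0 < r) by lra.
pose (P := fun x => x / r * mehler_remainder (x / r) a).
assert (Hir : 0 < / r) by now apply Rinv_0_lt_compat.
assert (Heps : 0 <= c / r <= 1 / 4).
{ split; [apply Rdiv_le_0_compat; lra|]. apply Rle_div_l; lra. }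
assert (HPx : forall x, 0 < x <= b -> Rabs (P x) <= x * (PI / r)).
{ intros x Hx. unfold P. rewrite Rabs_mult, Rabs_pos_eq by (apply Rdiv_le_0_compat; lra).
  replace (x * (PI / r)) with (x / r * PI) by (unfold Rdiv; ring).
  apply Rmult_le_compat_l; [apply Rdiv_le_0_compat; lra|]. apply mehler_remainder_bound; lra. }
assert (Hpr : 0 <= PI / r) by (apply Rdiv_le_0_compat; lra).
assert (Hcr : c / r = PI / r + b * (PI / r)) by (unfold c, Rdiv; ring).
destruct (perturbed_sine_nth_zero n (c / r) P) as (z & Hz1 & Hz2); trivial;
  [split; [exact Heps | split; [|split]]|].
- intros x Hx. fold b in Hx. pose proof (HPx x Hx). nra.
- intros x Hx. fold b in Hx. pose proof (HPx x Hx). assert (0 <= x * (b * (PI / r))) by (apply Rmult_le_pos; [lra | apply Rmult_le_pos; lra]). rewrite Hcr. lra.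
- intros x y Hx Hy. fold b in Hx, Hy. unfold P.
  replace (_ - _) with ((x - y) / r * mehler_remainder (x / r) a
    + y / r * (mehler_remainder (x / r) a - mehler_remainder (y / r) a)) by (unfold Rdiv; ring).
  eapply Rle_trans; [apply Rabs_triang|]. rewrite !Rabs_mult.
  rewrite (Rabs_pos_eq (y / r)) by (apply Rdiv_le_0_compat; lra).
  pose proof (mehler_remainder_bound (x / r) a ltac:(lra)) as B1.
  pose proof (mehler_remainder_lipschitz (x / r) (y / r) a ltac:(lra)) as B2.
  fold r in B2. replace (x / r - y / r) with ((x - y) / r) in B2 by (unfold Rdiv; ring).
  replace (Rabs ((x - y) / r)) with (Rabs (x - y) / r) in *.
  2:{ unfold Rdiv. rewrite Rabs_mult, (Rabs_pos_eq (/ r)); lra. }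
  replace (r * PI * (Rabs (x - y) / r)) with (PI * Rabs (x - y)) in B2 by (field; lra).
  replace (c / r * Rabs (x - y)) with (Rabs (x - y) / r * PI + b / r * (PI * Rabs (x - y)))
    by (unfold c; field; lra).
  pose proof (Rabs_pos (x - y)).
  apply Rplus_le_compat.
  + apply Rmult_le_compat_l; trivial. apply Rdiv_le_0_compat; lra.
  + apply Rmult_le_compat; trivial; try apply Rabs_pos.
    * apply Rdiv_le_0_compat; lra.
    * apply Rmult_le_compat_r; lra.
- exists (z / r). split.
  + apply is_nth_pos_zero_scale; trivial.
    revert Hz2. apply is_nth_pos_zero_ext. intros x Hx.
    pose proof (mehler_phase (x / r) a) as Hph.
    replace (2 * (x / r) * arcsinh a) with x in Hph by (unfold r; field; unfold r in Hr0; lra).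
    fold (P x) in Hph. rewrite <- Hph.
    assert (Hnz : x / r * PI * a <> 0).
    { assert (0 < x / r) by (apply Rdiv_lt_0_compat; lra). apply Rmult_integral_contrapositive_currified; [apply Rmult_integral_contrapositive_currified|]; lra. }
    split; intros E; apply RtoC_inj in E.
    * f_equal. apply Rmult_integral in E. tauto.
    * rewrite E. f_equal. ring.
  + replace (z / r - INR n * PI / r) with ((z - INR n * PI) * / r) by (unfold Rdiv; ring).
    rewrite Rabs_mult, (Rabs_pos_eq (/ r)) by lra.
    replace (3 * c / r ^ 2) with (3 * (c / r) * / r) by (field; lra).
    apply Rmult_le_compat_r; lra.
Qed.

(** * Asymptotics of the logarithmic negativity *)

(** Half-angle formula: with [y = 1 + 2 a^2], [y + sqrt (y^2 - 1)] is the square of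
    [a + sqrt (a^2 + 1)]. *)
Lemma arccosh_arcsinh (y : R) : 1 < y -> arccosh y = 2 * arcsinh (sqrt ((y - 1) / 2)).
Proof.
intros Hy. set (a := sqrt ((y - 1) / 2)).
assert (Ha : 0 < a) by (apply sqrt_lt_R0; lra).
assert (Ey : y = 2 * a ^ 2 + 1) by (unfold a; rewrite pow2_sqrt; lra).
unfold arccosh, arcsinh. destruct (sqrt_sqr1 a) as [Hp Hs].
set (w := sqrt (a ^ 2 + 1)) in *.
assert (Er : sqrt (y ^ 2 - 1) = 2 * a * w).
{ apply sqrt_lem_1.
  - rewrite Ey. pose proof (pow2_ge_0 (a ^ 2)). pose proof (pow2_ge_0 a). nra.
  - apply Rmult_le_pos; nra.
  - replace (2 * a * w * (2 * a * w)) with (4 * a ^ 2 * (w * w)) by ring. rewrite Hs, Ey. ring. }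
rewrite Er. replace (y + 2 * a * w) with ((a + w) * (a + w)).
- rewrite ln_mult by lra. ring.
- rewrite Ey. replace ((a + w) * (a + w)) with (a * a + 2 * a * w + w * w) by ring. rewrite Hs. ring.
Qed.

Lemma y_of_gt_1 (eta : R) : 0 < eta < 1 -> 1 < y_of eta.
Proof.
intros H. unfold y_of. apply Rlt_div_r; lra.
Qed.

(** [y + sqrt (y^2 - 1)] lies between [y] and [2 y], and [y = 2 / (1 - eta) - 1] lies between
    [1 / (1 - eta)] and [2 / (1 - eta)]. *)
Lemma rho_bounds (eta : R) : 0 < eta < 1 ->
  - ln (1 - eta) <= rho eta <= - ln (1 - eta) + ln 4.
Proof.
intros H. pose proof (y_of_gt_1 eta H) as Hy. unfold rho, arccosh.
assert (Hi : 0 < / (1 - eta)) by (apply Rinv_0_lt_compat; lra).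
assert (Ey : y_of eta = 2 * / (1 - eta) - 1) by (unfold y_of; field; lra).
assert (Hi1 : 1 < / (1 - eta)).
{ rewrite <- Rinv_1. apply Rinv_lt_contravar; lra. }
assert (Hs : 0 <= sqrt (y_of eta ^ 2 - 1) <= y_of eta).
{ split; [apply sqrt_pos|]. rewrite <- (sqrt_pow2 (y_of eta)) at 2 by lra. apply sqrt_le_1_alt. lra. }
rewrite <- ln_Rinv, <- ln_mult by lra.
split; apply ln_le; lra.
Qed.

Lemma s_zero_asymptotic (n : nat) : (1 <= n)%nat ->
  exists M r0, 0 < r0 /\ forall eta, 0 < eta < 1 -> r0 <= rho eta ->
    0 < s_zero n eta /\ Rabs (s_zero n eta - INR n * PI / rho eta) <= M / rho eta ^ 2.
Proof.
intros Hn. destruct (mehler_nth_zero n Hn) as (M & r0 & Hr0 & H).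
exists M, r0. split; trivial. intros eta He Hr. pose proof (y_of_gt_1 eta He) as Hy.
set (a := sqrt ((y_of eta - 1) / 2)).
assert (Er : rho eta = 2 * arcsinh a) by now apply arccosh_arcsinh.
destruct (H a) as (z & Hz1 & Hz2).
- apply sqrt_lt_R0. lra.
- now rewrite <- Er.
- assert (Hz : is_nth_pos_zero (fun s => conicalP s (y_of eta)) n z).
  { revert Hz1. apply is_nth_pos_zero_ext. intros s _. now rewrite conicalP_mehler. }
  replace (s_zero n eta) with z.
  + rewrite Er. split; trivial. apply Hz1.
  + apply (is_nth_pos_zero_unique _ _ _ _ Hz). unfold s_zero.
    apply epsilon_spec. now exists z.
Qed.

Lemma rho_lim : filterlim rho (at_left 1) (Rbar_locally p_infty).
Proof.
intros Q [K HK]. unfold filtermap, at_left, within.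
set (e := Rmin 1 (exp (- Rabs K - 1))).
assert (He : 0 < e) by (apply Rmin_pos; [lra | apply exp_pos]).
exists (mkposreal e He). intros x Hx Hlt. apply HK.
pose proof (Rmin_l 1 (exp (- Rabs K - 1))). pose proof (Rmin_r 1 (exp (- Rabs K - 1))).
change (Rabs (x - 1) < e) in Hx. rewrite Rabs_left in Hx by lra. unfold e in Hx.
destruct (rho_bounds x) as [B _]; [lra|].
assert (ln (1 - x) < - Rabs K - 1).
{ rewrite <- (ln_exp (- Rabs K - 1)). apply ln_increasing; lra. }
pose proof (Rle_abs K). lra.
Qed.

Lemma at_left_1_pos : at_left 1 (fun eta => 0 < eta < 1).
Proof.
exists (mkposreal 1 Rlt_0_1). intros x Hx Hlt.
change (Rabs (x - 1) < 1) in Hx. apply Rabs_def2 in Hx. lra.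
Qed.

Lemma rho_eventually_gt (K : R) : at_left 1 (fun eta => K < rho eta).
Proof. apply (rho_lim (fun r => K < r)). now exists K. Qed.

Lemma filterlim_rho_squeeze (f : R -> R) (l K : R) :
  at_left 1 (fun eta => Rabs (f eta - l) <= K / rho eta) -> filterlim f (at_left 1) (locally l).
Proof.
intros H Q [e He]. unfold filtermap.
generalize (filter_and _ _ H (rho_eventually_gt (Rabs K / e))). apply filter_imp.
intros eta [H1 H2]. apply He. change (Rabs (f eta - l) < e).
assert (Hp : 0 <= Rabs K / e) by (apply Rdiv_le_0_compat; [apply Rabs_pos | apply cond_pos]).
eapply Rle_lt_trans; [exact H1|]. apply Rlt_div_l; [lra|].
pose proof (cond_pos e). apply Rlt_div_l in H2; [|lra]. pose proof (Rle_abs K). lra.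
Qed.

Lemma tanh_pos (x : R) : 0 < x -> 0 < tanh x.
Proof.
intros Hx. unfold tanh. apply Rdiv_lt_0_compat; unfold sinh, cosh.
- assert (exp (- x) < exp x) by (apply exp_increasing; lra). lra.
- pose proof (exp_pos x). pose proof (exp_pos (- x)). lra.
Qed.

Lemma derivable_pt_lim_tanh_0 : derivable_pt_lim tanh 0 1.
Proof.
apply is_derive_Reals. unfold tanh, sinh, cosh. auto_derive.
- pose proof (exp_pos 0). pose proof (exp_pos (- 0)). lra.
- rewrite Ropp_0, exp_0. field.
Qed.

Lemma filterlim_ln_1 (f : R -> R) :
  filterlim f (at_left 1) (locally 1) -> filterlim (fun eta => ln (f eta)) (at_left 1) (locally 0).
Proof.
intros H. rewrite <- ln_1. eapply filterlim_comp; [exact H|].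
apply (ex_derive_continuous (K := R_AbsRing) (V := R_NormedModule) ln). eexists. apply is_derive_Reals, derivable_pt_lim_ln. lra.
Qed.

(** The difference is minus the base-2 logarithm of a product of three ratios tending to 1:
    [tanh (PI s) / (PI s)], [s rho / (n PI)] and [- ln (1 - eta) / rho]. *)
Lemma logneg_asymptotic (n : nat) : (1 <= n)%nat ->
  filterlim
    (fun eta : R =>
       logneg n eta - (Rlog 2 (- ln (1 - eta)) - Rlog 2 (INR n * PI ^ 2)))
    (at_left 1) (locally 0).
Proof.
intros Hn. pose proof PI_RGT_0 as HPI.
assert (HnR : 1 <= INR n) by (apply (le_INR 1); exact Hn).
assert (Hln2 : 0 < ln 2) by (rewrite <- ln_1; apply ln_increasing; lra).
assert (Hln4 : 0 < ln 4) by (rewrite <- ln_1; apply ln_increasing; lra).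
assert (HnP : 0 < INR n * PI) by (apply Rmult_lt_0_compat; lra).
destruct (s_zero_asymptotic n Hn) as (M & r0 & Hr0 & Hs).
(* The threshold combines [r0] for the zero asymptotics, 1 for [rho > 1], and [ln 4] for
   [- ln (1 - eta) > 0] by [rho_bounds]. *)
assert (Hev : at_left 1 (fun eta => (0 < eta < 1 /\ r0 + 1 + ln 4 < rho eta) /\
  0 < s_zero n eta /\ Rabs (s_zero n eta - INR n * PI / rho eta) <= M / rho eta ^ 2)).
{ generalize (filter_and _ _ at_left_1_pos (rho_eventually_gt (r0 + 1 + ln 4))). apply filter_imp.
  intros eta [H1 H2]. split; [now split | apply Hs; trivial; lra]. }
assert (HM : forall eta, 1 < rho eta -> Rabs (s_zero n eta - INR n * PI / rho eta) <= M / rho eta ^ 2 ->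
  Rabs (s_zero n eta * rho eta - INR n * PI) <= M / rho eta).
{ intros eta Hr He.
  replace (s_zero n eta * rho eta - INR n * PI) with ((s_zero n eta - INR n * PI / rho eta) * rho eta) by (field; lra).
  rewrite Rabs_mult, (Rabs_pos_eq (rho eta)) by lra.
  replace (M / rho eta) with (M / rho eta ^ 2 * rho eta) by (field; lra).
  apply Rmult_le_compat_r; lra. }
assert (LU : filterlim (fun eta => s_zero n eta * rho eta / (INR n * PI)) (at_left 1) (locally 1)).
{ apply filterlim_rho_squeeze with (M / (INR n * PI)). revert Hev. apply filter_imp.
  intros eta [[H1 H2] [H3 H4]]. apply HM in H4; [|lra].
  replace (s_zero n eta * rho eta / (INR n * PI) - 1) with ((s_zero n eta * rho eta - INR n * PI) * / (INR n * PI)) by (field; lra).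
  assert (0 < / (INR n * PI)) by now apply Rinv_0_lt_compat.
  rewrite Rabs_mult, (Rabs_pos_eq (/ (INR n * PI))) by lra.
  replace (M / (INR n * PI) / rho eta) with (M / rho eta * / (INR n * PI)) by (field; lra).
  apply Rmult_le_compat_r; lra. }
assert (LV : filterlim (fun eta => - ln (1 - eta) / rho eta) (at_left 1) (locally 1)).
{ apply filterlim_rho_squeeze with (ln 4). revert Hev. apply filter_imp.
  intros eta [[H1 H2] _]. destruct (rho_bounds eta H1).
  replace (- ln (1 - eta) / rho eta - 1) with (- ((rho eta + ln (1 - eta)) / rho eta)) by (field; lra).
  rewrite Rabs_Ropp, Rabs_pos_eq by (apply Rdiv_le_0_compat; lra).
  apply Rmult_le_compat_r; [apply Rlt_le, Rinv_0_lt_compat|]; lra. }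
assert (LS : filterlim (s_zero n) (at_left 1) (locally 0)).
{ apply filterlim_rho_squeeze with (INR n * PI + Rabs M). revert Hev. apply filter_imp.
  intros eta [[H1 H2] [H3 H4]]. apply HM in H4; [|lra]. rewrite Rminus_0_r.
  assert (M / rho eta <= Rabs M).
  { apply Rle_div_l; [lra|]. pose proof (Rle_abs M). pose proof (Rabs_pos M). nra. }
  rewrite Rabs_pos_eq by lra. apply Rle_div_r; [lra|]. apply Rabs_le_between in H4. lra. }
assert (LT : filterlim (fun eta => tanh (PI * s_zero n eta) / (PI * s_zero n eta)) (at_left 1) (locally 1)).
{ intros Q [e He]. destruct (derivable_pt_lim_tanh_0 e (cond_pos e)) as (del & Hdel).
  assert (Hd : 0 < del / PI) by (apply Rdiv_lt_0_compat; [apply cond_pos | lra]).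
  generalize (filter_and _ _ Hev (LS _ (locally_ball 0 (mkposreal _ Hd)))).
  unfold filtermap. apply filter_imp. intros eta [[_ [H3 _]] H5]. apply He.
  change (Rabs (s_zero n eta - 0) < del / PI) in H5.
  rewrite Rminus_0_r, Rabs_pos_eq in H5 by lra. apply Rlt_div_r in H5; [|lra].
  assert (0 < PI * s_zero n eta) by (apply Rmult_lt_0_compat; lra).
  specialize (Hdel (PI * s_zero n eta)).
  rewrite Rplus_0_l in Hdel. replace (tanh 0) with 0 in Hdel by (unfold tanh; rewrite sinh_0; unfold Rdiv; ring).
  rewrite Rminus_0_r in Hdel. apply Hdel; [lra|]. rewrite Rabs_pos_eq; lra. }
apply filterlim_ln_1 in LT, LU, LV.
pose (h := fun eta => - / ln 2 * (ln (tanh (PI * s_zero n eta) / (PI * s_zero n eta))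
   + (ln (s_zero n eta * rho eta / (INR n * PI)) + ln (- ln (1 - eta) / rho eta)))).
apply filterlim_ext_loc with h.
- revert Hev. apply filter_imp. intros eta [[H1 H2] [H3 H4]]. destruct (rho_bounds eta H1).
  assert (Hps : 0 < PI * s_zero n eta) by (apply Rmult_lt_0_compat; lra).
  pose proof (tanh_pos _ Hps) as Ht.
  assert (HL : 0 < - ln (1 - eta)) by lra.
  assert (HR : 0 < rho eta) by lra.
  assert (HsR : 0 < s_zero n eta * rho eta) by (apply Rmult_lt_0_compat; lra).
  assert (Hn0 : 0 < INR n) by lra.
  assert (HP0 : 0 < PI) by lra.
  assert (HP2 : 0 < PI ^ 2) by (apply pow_lt; lra).
  unfold h, logneg, Rlog.
  rewrite (ln_div (tanh _)), (ln_div (s_zero n eta * rho eta)), (ln_div (- ln (1 - eta))),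
    (ln_mult PI (s_zero n eta)), (ln_mult (s_zero n eta)), (ln_mult (INR n) PI), (ln_mult (INR n)) by assumption.
  replace (PI ^ 2) with (PI * PI) by ring. rewrite (ln_mult PI PI) by lra. field. lra.
- replace 0 with (- / ln 2 * (0 + (0 + 0))) by ring. unfold h.
  apply (filterlim_comp _ _ _ _ (fun z => - / ln 2 * z) _ (locally (0 + (0 + 0)))).
  + eapply filterlim_comp_2; [exact LT | |apply (filterlim_plus (V := R_NormedModule))].
    eapply filterlim_comp_2; [exact LU | exact LV | apply (filterlim_plus (V := R_NormedModule))].
  + apply (filterlim_scal_r (K := R_AbsRing) (V := R_NormedModule)).
Qed.

Lemma ln_increment (x y c : R) : 0 < c -> c <= x -> c <= y ->
  Rabs (ln x - ln y) <= Rabs (x - y) / c.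
Proof.
intros Hc. assert (W : forall x y, c <= x -> c <= y -> ln x - ln y <= Rabs (x - y) / c).
{ clear x y. intros x y Hx Hy. rewrite <- ln_div by lra.
  assert (Hl : ln (x / y) <= x / y - 1).
  { apply Rle_trans with (ln (exp (x / y - 1))); [|rewrite ln_exp; lra].
    apply ln_le; [apply Rdiv_lt_0_compat; lra|]. pose proof (exp_ineq1_le (x / y - 1)). lra. }
  eapply Rle_trans; [exact Hl|]. replace (x / y - 1) with ((x - y) * / y) by (field; lra).
  assert (0 < / y <= / c) by (split; [apply Rinv_0_lt_compat | apply Rinv_le_contravar]; lra).
  pose proof (Rle_abs (x - y)). pose proof (Rabs_pos (x - y)).
  apply Rle_trans with (Rabs (x - y) * / y).
  - apply Rmult_le_compat_r; lra.
  - apply Rmult_le_compat_l; lra. }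
intros Hx Hy. apply Rabs_le. pose proof (W x y Hx Hy). pose proof (W y x Hy Hx) as K.
rewrite Rabs_minus_sym in K. lra.
Qed.

Theorem mainTheorem5 :
  forall n : nat, (1 <= n)%nat ->
    is_bigO (at_left 1)
      (fun eta : R => s_zero n eta - INR n * PI / rho eta)
      (fun eta : R => / rho eta ^ 2)
    /\
    filterlim
      (fun eta : R =>
         logneg n eta - (Rlog 2 (- ln (1 - eta)) - Rlog 2 (INR n * PI ^ 2)))
      (at_left 1) (locally 0)
    /\
    (forall eps : R, 0 < eps -> exists delta : R, 0 < delta /\
       forall l d : R, 0 < l -> 0 < d -> d / l < delta ->
         Rabs (logneg n (/ (1 + d / l) ^ 2)
               - (Rlog 2 (- ln (d / l)) - Rlog 2 (INR n * PI ^ 2))) < eps).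
Proof.
intros n Hn. split; [|split].
- destruct (s_zero_asymptotic n Hn) as (M & r0 & Hr0 & Hs). exists M.
  generalize (filter_and _ _ at_left_1_pos (rho_eventually_gt r0)). apply filter_imp.
  intros eta [H1 H2]. destruct (Hs eta H1 ltac:(lra)) as [_ B].
  rewrite (Rabs_pos_eq (/ rho eta ^ 2)); [exact B|].
  apply Rlt_le, Rinv_0_lt_compat, pow_lt. lra.
- now apply logneg_asymptotic.
- intros eps Heps.
  assert (Heps2 : 0 < eps / 2) by lra.
  destruct (logneg_asymptotic n Hn _ (locally_ball 0 (mkposreal _ Heps2))) as (e & He).
  assert (Hln2 : 0 < ln 2) by (rewrite <- ln_1; apply ln_increasing; lra).
  assert (Hln2' : ln 2 < 1).
  { apply Rlt_le_trans with (ln (exp 1)); [|rewrite ln_exp; lra].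
    apply ln_increasing; [lra|]. pose proof (exp_ineq1 1 ltac:(lra)). lra. }
  (* Chosen so that [eps / 2 * ln 2 * K = 1]: two arguments above [K] at distance at most [ln 2 < 1]
     have base-2 logarithms within [eps / 2]. *)
  set (K := 2 / (eps * ln 2)).
  assert (HK : 0 < K) by (apply Rdiv_lt_0_compat; [lra | apply Rmult_lt_0_compat; lra]).
  (* For [x < 1] the ratio [(1 - eta) / x] lies in [[1/2, 2]]. Hence [e / 3] forces [1 - eta < e],
     and the exponential forces [- ln x > K + 1], leaving [- ln (1 - eta) > K] after a loss of at
     most [ln 2]. *)
  set (delta := Rmin 1 (Rmin (e / 3) (exp (- (K + 1))))).
  assert (He3 : 0 < e / 3) by (pose proof (cond_pos e); lra).
  exists delta. split.
  { apply Rmin_pos; [lra | apply Rmin_pos; [trivial | apply exp_pos]]. }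
  intros l d Hl Hd Hx. assert (Hx0 : 0 < d / l) by now apply Rdiv_lt_0_compat.
  revert Hx Hx0. generalize (d / l). intros x Hx Hx0.
  assert (Hxs : x < 1 /\ x < e / 3 /\ x < exp (- (K + 1))).
  { unfold delta in Hx. pose proof (Rmin_l 1 (Rmin (e / 3) (exp (- (K + 1))))).
    pose proof (Rmin_r 1 (Rmin (e / 3) (exp (- (K + 1))))).
    pose proof (Rmin_l (e / 3) (exp (- (K + 1)))). pose proof (Rmin_r (e / 3) (exp (- (K + 1)))). lra. }
  set (eta := / (1 + x) ^ 2).
  assert (E1 : 1 - eta = x * ((2 + x) / (1 + x) ^ 2)) by (unfold eta; field; lra).
  assert (Hw : 1 / 2 <= (2 + x) / (1 + x) ^ 2 <= 2).
  { assert (0 <= x * x <= 1) by nra. assert (0 < (1 + x) ^ 2) by nra.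
    split; [apply (Rle_div_r (1 / 2)) | apply Rle_div_l]; lra. }
  assert (Heta : Rabs (logneg n eta - (Rlog 2 (- ln (1 - eta)) - Rlog 2 (INR n * PI ^ 2))) < eps / 2).
  { assert (B : 0 < 1 - eta < e) by (rewrite E1; nra).
    assert (Bd : ball 1 e eta) by (change (Rabs (eta - 1) < e); rewrite Rabs_left; lra).
    pose proof (He eta Bd ltac:(lra)) as R1. rewrite <- (Rminus_0_r (_ - _)). exact R1. }
  assert (Hlx : K + 1 < - ln x).
  { assert (ln x < - (K + 1)); [|lra]. rewrite <- (ln_exp (- (K + 1))). apply ln_increasing; lra. }
  assert (Hdiff : Rabs (- ln (1 - eta) - - ln x) <= ln 2).
  { rewrite E1, ln_mult by lra.
    replace (_ - _) with (- ln ((2 + x) / (1 + x) ^ 2)) by ring.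
    rewrite Rabs_Ropp. apply Rabs_le. split; [|apply ln_le; lra].
    rewrite <- ln_Rinv by lra. apply ln_le; lra. }
  assert (Hlog : Rabs (Rlog 2 (- ln (1 - eta)) - Rlog 2 (- ln x)) < eps / 2).
  { unfold Rlog, Rdiv at 1 2. rewrite <- Rmult_minus_distr_r, Rabs_mult.
    rewrite (Rabs_pos_eq (/ ln 2)) by (apply Rlt_le, Rinv_0_lt_compat; lra).
    apply Rlt_div_l; [lra|].
    apply Rabs_le_between in Hdiff as Hdiff'.
    eapply Rle_lt_trans; [apply (ln_increment _ _ K); lra|].
    apply Rlt_div_l; [lra|].
    replace (eps / 2 * ln 2 * K) with 1 by (unfold K; field; lra). lra. }
  replace (_ - _) with ((logneg n eta - (Rlog 2 (- ln (1 - eta)) - Rlog 2 (INR n * PI ^ 2)))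
    + (Rlog 2 (- ln (1 - eta)) - Rlog 2 (- ln x))) by ring.
  eapply Rle_lt_trans; [apply Rabs_triang|]. lra.
Qed.
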